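(* Let $(M,\varphi,\xi_\alpha,\eta^\alpha,g)$ be a Lorentzian $\mathcal{S}$-manifold with $\dim(M)=2n+s$, $s\geqslant 2$, where $\xi_1$ denotes the timelike characteristic vector field. Then for any $p\in M$, the null Osserman condition with respect to $(\xi_1)_p$ does not hold, i.e. $(M,g)$ is not null Osserman with respect to $(\xi_1)_p$.
   Context: All manifolds are smooth and connected. Globally framed $f$-manifolds. A globally framed $f$-manifold ($g.f.f$-manifold) $(M,\varphi,\xi_\alpha,\eta^\alpha)$, $\alpha\in\{1,\dots,s\}$, $s\ge 1$, $\dim M=2n+s$, is a manifold with a non-vanishing $(1,1)$-tensor field $\varphi$ of constant rank $2n$, vector fields $\xi_1,\dots,\xi_s$ and $1$-forms $\eta^1,\dots,\eta^s$ such that $\varphi^2=-I+\sum_{\alpha}\eta^\alpha\otimes\xi_\alpha$ and $\eta^\alpha(\xi_\beta)=\delta^\alpha_\beta$ (so $\varphi^3+\varphi=0$, $\varphi\xi_\alpha=0$, $\eta^\alpha\circ\varphi=0$, and $T_pM=\mathrm{Im}(\varphi_p)\oplus\mathrm{span}((\xi_1)_p,\dots,(\xi_s)_p)$). The $\xi_\alpha$ are the characteristic vector fields. It is normal if $[\varphi,\varphi]+2\sum_\alpha d\eta^\alpha\otimes\xi_\alpha=0$, where $[\varphi,\varphi](X,Y)=\varphi^2[X,Y]+[\varphi X,\varphi Y]-\varphi[\varphi X,Y]-\varphi[X,\varphi Y]$ and $2d\eta(X,Y)=X(\eta(Y))-Y(\eta(X))-\eta([X,Y])$. An indefinite metric $g$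 is compatible if $g(\varphi X,\varphi Y)=g(X,Y)-\sum_\alpha\varepsilon_\alpha\eta^\alpha(X)\eta^\alpha(Y)$, where $\varepsilon_\alpha=g(\xi_\alpha,\xi_\alpha)=\pm1$; then $(M,\varphi,\xi_\alpha,\eta^\alpha,g)$ is an indefinite metric $g.f.f$-manifold. It is an indefinite $\mathcal{S}$-manifold if it is normal and $d\eta^\alpha=\Phi$ for every $\alpha$, where $\Phi(X,Y)=g(X,\varphi Y)$. It is Lorentzian if $g$ is Lorentzian (exactly one minus sign); then exactly one of the $\xi_\alpha$ is timelike, and it is always labelled $\xi_1$ (so $\varepsilon_1=-1$, $\varepsilon_\alpha=1$ for $\alpha\ge2$). Curvature convention: $R(Z,W)=[\nabla_Z,\nabla_W]-\nabla_{[Z,W]}$, $\nabla$ the Levi-Civita connection. Null Jacobi operators. For a lightlike $u\in T_pM$ ($u\ne0$, $g_p(u,u)=0$), let $\bar u^\bot=u^\bot/\mathrm{span}(u)$ with projection $\pi\colon u^\bot\to\bar u^\bot$ and the positive definite inner product $\bar g(\pi(x),\pi(y))=g_p(x,y)$. The Jacobi operator $\bar R_u\colon\bar u^\bot\to\bar u^\bot$ is $\bar R_u(\pi(x))=\pi(R_p(x,u)u)$; it is self-adjoint. For a unit timelike $z\in T_pM$, $N(z)=\{u\in T_pM : g_p(u,u)=0,\ g_p(u,z)=-1\}$. $(M,g)$ is null Osserman with respect to $z$ if the eigenvalues of $\bar R_u$ and their multiplicities are independent of $u\in N(z)$. *)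

(* Defs.v *)
From HB Require Import structures.
From mathcomp Require Import all_boot all_order all_algebra.
From mathcomp Require Import all_classical all_reals all_analysis.

Set Implicit Arguments.
Unset Strict Implicit.
Unset Printing Implicit Defensive.

Import Order.TTheory GRing.Theory Num.Theory.
Import numFieldNormedType.Exports.

Local Open Scope classical_set_scope.
Local Open Scope ring_scope.

Section SmoothMaps.
Variables (R : realType) (m : nat) (V : normedModType R).

(* [F] is C^k at the points of [U]; only used for open [U]. *)
Fixpoint Ck (k : nat) (U : set 'rV[R]_m) (F : 'rV[R]_m -> V) : Prop :=
  match k with
  | 0%N => forall y, U y -> {for y, continuous F}
  | k'.+1 => (forall y, U y -> differentiable F y) /\
             (forall v : 'rV[R]_m, Ck k' U (fun y => 'D_v F y))
  end.

Definition Cinfty (U : set 'rV[R]_m) (F : 'rV[R]_m -> V) : Prop :=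
  forall k, Ck k U F.

End SmoothMaps.

(* Connected, Hausdorff, second countable smooth [m]-manifolds without boundary.
   The atlas is indexed by the points of the manifold, [chart p] being a chart
   around [p]; every smooth structure is given by such an atlas. [chart p] and
   its inverse [ichart p] are total functions that only matter on [dom p] and
   [chart p @` dom p]. *)
Record smoothManifold (R : realType) (m : nat) := SmoothManifold {
  carrier :> topologicalType;
  dom : carrier -> set carrier;
  chart : carrier -> carrier -> 'rV[R]_m;
  ichart : carrier -> 'rV[R]_m -> carrier;
  manifold_hausdorff : hausdorff_space carrier;
  manifold_second_countable : @second_countable carrier;
  manifold_connected : connected [set: carrier];
  dom_open : forall p, open (dom p);
  dom_self : forall p, dom p p;
  chart_open : forall p, open (chart p @` dom p);
  chartK : forall p q, dom p q -> ichart p (chart p q) = q;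
  chart_continuous : forall p q, dom p q -> {for q, continuous (chart p)};
  ichart_continuous : forall p y, (chart p @` dom p) y ->
    {for y, continuous (ichart p)};
  transition_smooth : forall p q,
    Cinfty (chart p @` (dom p `&` dom q)) (chart q \o ichart p)
}.

Section Geometry.
Variables (R : realType) (m : nat) (M : smoothManifold R m).

(* The tangent space at [p] is identified with R^m by means of the distinguished
   chart [chart p]; [coord_change p q r] sends the components with respect to
   [chart p] of a tangent vector at [r] to its components with respect to
   [chart q]. *)
Definition coord_change (p q r : M) : 'rV[R]_m -> 'rV[R]_m :=
  'd (chart q \o ichart p) (chart p r).

Definition vfield : Type := M -> 'rV[R]_m.

(* components of [X] in [chart p], as a function of the coordinates *)
Definition vfield_in_chart (p : M) (X : vfield) (y : 'rV[R]_m) : 'rV[R]_m :=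
  let q := ichart p y in coord_change q p q (X q).

(* Fields and functions are considered locally: as total functions of which only
   the values on a given open set [W] matter. *)
Definition smooth_fun (W : set M) (f : M -> R) : Prop :=
  forall p, Cinfty (chart p @` (dom p `&` W)) (f \o ichart p : _ -> R^o).

Definition smooth_vfield (W : set M) (X : vfield) : Prop :=
  forall p, Cinfty (chart p @` (dom p `&` W)) (vfield_in_chart p X).

(* the derivative X(f) *)
Definition vderive (X : vfield) (f : M -> R) (p : M) : R :=
  'D_(X p) (f \o ichart p : _ -> R^o) (chart p p).

Definition bracket (X Y : vfield) : vfield := fun p =>
  'D_(X p) (vfield_in_chart p Y) (chart p p)
  - 'D_(Y p) (vfield_in_chart p X) (chart p p).

(* Tensor fields: pointwise multilinear, and turning local smooth vector fields
   into smooth vector fields, resp. functions. *)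
Definition endo_field : Type := M -> 'End('rV[R]_m).
Definition one_form : Type := M -> 'Hom('rV[R]_m, R^o).
Definition two_tensor : Type := M -> 'rV[R]_m -> 'rV[R]_m -> R.

Definition endo_app (phi : endo_field) (X : vfield) : vfield :=
  fun p => phi p (X p).
Definition form_app (eta : one_form) (X : vfield) : M -> R :=
  fun p => eta p (X p).
Definition two_app (g : two_tensor) (X Y : vfield) : M -> R :=
  fun p => g p (X p) (Y p).

Definition smooth_endo (phi : endo_field) : Prop :=
  forall (W : set M) (X : vfield),
    open W -> smooth_vfield W X -> smooth_vfield W (endo_app phi X).
Definition smooth_form (eta : one_form) : Prop :=
  forall (W : set M) (X : vfield),
    open W -> smooth_vfield W X -> smooth_fun W (form_app eta X).
Definition smooth_two_tensor (g : two_tensor) : Prop :=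
  forall (W : set M) (X Y : vfield),
    open W -> smooth_vfield W X -> smooth_vfield W Y ->
    smooth_fun W (two_app g X Y).

(* exterior derivative, with the factor 1/2 *)
Definition dform (eta : one_form) (X Y : vfield) (p : M) : R :=
  2^-1 * (vderive X (form_app eta Y) p - vderive Y (form_app eta X) p
          - form_app eta (bracket X Y) p).

Definition nijenhuis (phi : endo_field) (X Y : vfield) : vfield := fun p =>
  phi p (phi p (bracket X Y p))
  + bracket (endo_app phi X) (endo_app phi Y) p
  - phi p (bracket (endo_app phi X) Y p)
  - phi p (bracket X (endo_app phi Y) p).

Record is_pseudo_metric (g : two_tensor) : Prop := IsPseudoMetric {
  metric_linear : forall p (y x1 x2 : 'rV[R]_m) (a : R),
    g p (a *: x1 + x2) y = a * g p x1 y + g p x2 y;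
  metric_sym : forall p x y, g p x y = g p y x;
  metric_nondegenerate : forall p x, (forall y, g p x y = 0) -> x = 0;
  metric_smooth : smooth_two_tensor g
}.

Definition is_lorentzian (g : two_tensor) : Prop :=
  is_pseudo_metric g /\
  forall p, exists2 e : 'M[R]_m, e \in unitmx &
    forall i j : 'I_m, g p (row i e) (row j e) =
      if i != j then 0 else if (i == 0 :> nat)%N then -1 else 1.

(* The metric, torsion-free connection. That [nabla X Y] only depends on the germs
   of [X] and [Y] is a consequence of the axioms (Koszul formula). *)
Record is_levi_civita (g : two_tensor) (nabla : vfield -> vfield -> vfield) :
    Prop := IsLeviCivita {
  lc_smooth : forall (W : set M) X Y, open W ->
    smooth_vfield W X -> smooth_vfield W Y -> smooth_vfield W (nabla X Y);
  lc_linear_l : forall (W : set M) X1 X2 Y (f : M -> R), open W ->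
    smooth_vfield W X1 -> smooth_vfield W X2 -> smooth_vfield W Y ->
    smooth_fun W f ->
    forall p, W p -> nabla (fun q => f q *: X1 q + X2 q) Y p =
                     f p *: nabla X1 Y p + nabla X2 Y p;
  lc_add_r : forall (W : set M) X Y1 Y2, open W ->
    smooth_vfield W X -> smooth_vfield W Y1 -> smooth_vfield W Y2 ->
    forall p, W p -> nabla X (fun q => Y1 q + Y2 q) p =
                     nabla X Y1 p + nabla X Y2 p;
  lc_leibniz : forall (W : set M) X Y (f : M -> R), open W ->
    smooth_vfield W X -> smooth_vfield W Y -> smooth_fun W f ->
    forall p, W p -> nabla X (fun q => f q *: Y q) p =
                     vderive X f p *: Y p + f p *: nabla X Y p;
  lc_torsion_free : forall (W : set M) X Y, open W ->
    smooth_vfield W X -> smooth_vfield W Y ->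
    forall p, W p -> nabla X Y p - nabla Y X p = bracket X Y p;
  lc_metric : forall (W : set M) X Y Z, open W ->
    smooth_vfield W X -> smooth_vfield W Y -> smooth_vfield W Z ->
    forall p, W p -> vderive X (two_app g Y Z) p =
                     g p (nabla X Y p) (Z p) + g p (Y p) (nabla X Z p)
}.

Definition curvature (nabla : vfield -> vfield -> vfield) (X Y Z : vfield) :
    vfield := fun p =>
  nabla X (nabla Y Z) p - nabla Y (nabla X Z) p - nabla (bracket X Y) Z p.

(* the extension of [x], tangent at [p], with constant components in [chart p] *)
Definition const_extension (p : M) (x : 'rV[R]_m) : vfield :=
  fun q => coord_change p q q x.

(* R_p(x, y) z; by tensoriality the choice of the extensions is irrelevant *)
Definition curvature_at (nabla : vfield -> vfield -> vfield) (p : M)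
    (x y z : 'rV[R]_m) : 'rV[R]_m :=
  curvature nabla (const_extension p x) (const_extension p y)
    (const_extension p z) p.

(* [U] is the subspace u^perp. *)
Definition is_orthogonal_of (g : two_tensor) (p : M) (u : 'rV[R]_m)
    (U : {vspace 'rV[R]_m}) : Prop :=
  forall x, (x \in U) = (g p x u == 0).

(* [pi : U -> Q] is the projection of [U] = u^perp onto its quotient by the line
   spanned by [u]. *)
Definition is_quotient_by (u : 'rV[R]_m) (U : {vspace 'rV[R]_m})
    (Q : vectType R) (pi : {linear subvs_of U -> Q}) : Prop :=
  (forall y, exists x, pi x = y) /\
  (forall x, pi x = 0 <-> vsval x \in <[u]>%VS).

(* [Ru] is the Jacobi operator of the lightlike vector [u], acting on the model
   [Q] of the quotient of u^perp by [u]. *)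
Definition is_null_jacobi (g : two_tensor) (nabla : vfield -> vfield -> vfield)
    (p : M) (u : 'rV[R]_m) (Q : vectType R) (Ru : 'End(Q)) : Prop :=
  exists (U : {vspace 'rV[R]_m}) (pi : {linear subvs_of U -> Q}),
    [/\ is_orthogonal_of g p u U, is_quotient_by u pi &
        forall x : subvs_of U, exists2 y : subvs_of U,
          vsval y = curvature_at nabla p (vsval x) u u &
          Ru (pi x) = pi y].

(* N(z) *)
Definition null_congruence (g : two_tensor) (p : M) (z : 'rV[R]_m) :
    set ('rV[R]_m) := [set u | g p u u = 0 /\ g p u z = -1].

(* The multiplicity of [lam] is the dimension of its eigenspace (the operators
   are self-adjoint for a definite inner product); it is 0 exactly when [lam] is
   not an eigenvalue. *)
Definition null_osserman (g : two_tensor)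
    (nabla : vfield -> vfield -> vfield) (p : M) (z : 'rV[R]_m) : Prop :=
  forall u v : 'rV[R]_m, null_congruence g p z u -> null_congruence g p z v ->
  forall (Qu Qv : vectType R) (Ru : 'End(Qu)) (Rv : 'End(Qv)),
    is_null_jacobi g nabla p u Ru -> is_null_jacobi g nabla p v Rv ->
  forall lam : R, \dim (passmx.leigenspace Ru lam) = \dim (passmx.leigenspace Rv lam).

End Geometry.

Record gff_structure (R : realType) (n s : nat)
    (M : smoothManifold R (2 * n + s)) := GffStructure {
  gff_phi : endo_field M;
  gff_xi : 'I_s -> vfield M;
  gff_eta : 'I_s -> one_form M;
  gff_phi_smooth : smooth_endo gff_phi;
  gff_xi_smooth : forall a, smooth_vfield [set: M] (gff_xi a);
  gff_eta_smooth : forall a, smooth_form (gff_eta a);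
  gff_phi_neq0 : forall p, gff_phi p != 0;
  gff_phi_rank : forall p, \dim (limg (gff_phi p)) = (2 * n)%N;
  gff_phi2 : forall p (x : 'rV[R]_(2 * n + s)), gff_phi p (gff_phi p x) =
    - x + \sum_(a < s) gff_eta a p x *: gff_xi a p;
  gff_eta_xi : forall p a b, gff_eta a p (gff_xi b p) = (a == b)%:R
}.

Section IndefiniteS.
Variables (R : realType) (n s : nat) (M : smoothManifold R (2 * n + s)).
Variables (S : gff_structure M) (eps : 'I_s -> R) (g : two_tensor M).

Local Notation phi := (gff_phi S).
Local Notation xi := (gff_xi S).
Local Notation eta := (gff_eta S).

(* [phi, phi] + 2 sum_a d eta^a (x) xi_a = 0 *)
Definition is_normal : Prop :=
  forall (W : set M) X Y, open W -> smooth_vfield W X -> smooth_vfield W Y ->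
  forall p, W p ->
    nijenhuis phi X Y p + 2 *: \sum_(a < s) dform (eta a) X Y p *: xi a p = 0.

Record is_indefinite_metric_gff : Prop := IsIndefiniteMetricGff {
  img_metric : is_pseudo_metric g;
  img_eps : forall a, eps a = 1 \/ eps a = -1;
  img_xi : forall p a, g p (xi a p) (xi a p) = eps a;
  img_compatible : forall p x y, g p (phi p x) (phi p y) =
    g p x y - \sum_(a < s) eps a * eta a p x * eta a p y
}.

Record is_indefinite_S : Prop := IsIndefiniteS {
  indefS_metric : is_indefinite_metric_gff;
  indefS_normal : is_normal;
  indefS_dform : forall (W : set M) X Y, open W ->
    smooth_vfield W X -> smooth_vfield W Y ->
    forall a p, W p -> dform (eta a) X Y p = g p (X p) (phi p (Y p))
}.

End IndefiniteS.

(* Main.v *)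
(** Let [xi_1] be timelike and [xi_2] another characteristic field. Normality gives
    [L_xi phi = 0] and [d Phi = d d eta = 0] gives [L_xi Phi = 0], so the [xi_a] are
    Killing fields and Koszul's formula reads [nabla_X xi_a = - eps_a phi X]. Hence
    [R(X, xi_b) xi_a = - eps_a eps_b phi^2 X].
    For [u = xi_1 + xi_2] this yields [R(x, u) u = - (eps_1 + eps_2)^2 phi^2 x = 0],
    so the Jacobi operator of [u] vanishes. For [v = xi_1 + w], with [w] a unit
    vector of the image of [phi], [g(R(xi_2, v) v, xi_2) = g(R(v, xi_2) xi_2, v)
    = - g(phi^2 w, w) = 1], so that of [v] does not. The eigenvalue [0] therefore
    has different multiplicities. *)

Require Import Defs.
From HB Require Import structures.
From mathcomp Require Import all_boot all_order all_algebra.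
From mathcomp Require Import all_classical all_reals all_analysis.
From mathcomp Require Import ring lra.

Set Implicit Arguments.
Unset Strict Implicit.
Unset Printing Implicit Defensive.

Import Order.TTheory GRing.Theory Num.Theory.
Import numFieldNormedType.Exports.

Local Open Scope classical_set_scope.
Local Open Scope ring_scope.

(** * Directional derivatives and the symmetry of second derivatives *)

Section Differentiability.
Variables (R : realType) (U V : normedModType R).
Implicit Types (F G : U -> V) (f : U -> R^o) (x v : U).

(** Vector fields are total functions that matter only on an open set, and tangent vectors are read
    in the distinguished chart of their base point. Brackets are therefore handled through their
    action on functions: [bracket X Y] acts as a commutator once second derivatives commute, and the
    Jacobi identity, which stands behind L_xi Phi = 0, follows from that. The value R_p(x, y) z is
    defined by extensions with constant coordinates, while the formula for R(X, xi_b) xi_a concerns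
    the fields xi themselves; tensoriality of the curvature connects the two. L_xi phi = 0 and L_xi
    Phi = 0 together only control L_xi g on pairs (X, phi Y); the directions xi_b have to be treated
    separately before xi_a is known to be Killing. The Osserman condition quantifies over all models
    of the null Jacobi operators, so refuting it requires constructing such operators for u and v.
    Their spaces have equal dimension, hence equal multiplicities of 0 would force the operator of v
    to vanish as well. *)

Lemma near_eq_continuous F G x : {near x, F =1 G} ->
  {for x, continuous F} -> {for x, continuous G}.
Proof.
move=> FG; rewrite /prop_for /continuous_at (nbhs_singleton FG) => cF.
by apply: cvg_trans cF; apply: near_eq_cvg.
Qed.

Lemma near_eq_diff F G x : {near x, F =1 G} -> differentiable F x ->
  differentiable G x /\ 'd G x = 'd F x :> (U -> V).
Proof.
move=> FG dF.
have oG : G \o shift x = cst (G x) + 'd F x +o_ 0 id.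
  apply/eqaddoP => e e0.
  have /diff_locally /eqaddoP /(_ e e0) := dF.
  rewrite (nbhs_singleton FG); apply: filter_app.
  have : \forall y \near 0, F (y + x) = G (y + x).

    by rewrite (near_shift 0 x) subr0 in FG.
  apply: filterS => y FGy.
  by rewrite /= -![(_ + _ : _ -> _) _]/(_ + _) -![(- _ : _ -> _) _]/(- _) /= FGy.
have cF : continuous ('d F x) by exact: diff_continuous.
have dE : 'd G x = 'd F x :> (U -> V) by exact: diff_unique.
split; last exact: dE.
by apply/diff_locallyP; rewrite dE; split.
Qed.

Lemma scale_differentiable f F x : differentiable f x ->
  differentiable F x -> differentiable (fun y => f y *: F y) x.
Proof.
move=> df dF.
have bilin : bilinear_for
    (GRing.Scale.Law.clone _ _ *:%R _) (GRing.Scale.Law.clone _ _ *:%R _)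
    (fun (a : R^o) (w : V) => a *: w).
  split=> [w|a] b y z /=; first by rewrite scalerDl scalerA.
  by rewrite scalerDr !scalerA mulrC.
pose bM := bilinear_isBilinear.Build R R^o V V _ _ _ bilin.
pose B : {bilinear R^o -> V -> V} := HB.pack (fun (a : R^o) (w : V) => a *: w) bM.
apply: (@differentiable_comp _ _ _ _ (fun y => (f y, F y)) (fun q => B q.1 q.2)).
  exact: differentiable_pair.
by apply: differentiable_bilin => q; exact: scale_continuous.
Qed.

Lemma derive_scale f F x v : differentiable f x -> differentiable F x ->
  'D_v (fun y => f y *: F y) x = f x *: 'D_v F x + 'D_v f x *: F x.
Proof.
move=> df dF.
(* In the splitting of the difference quotient below, the second summand carries [F] at the shifted
   point, so its limit uses continuity of [F] along the line. *)
have cF : {for 0, continuous (fun h : R => F (h *: v + x))}.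
  apply: differentiable_continuous; apply/derivable1_diffP/(derivable1P _ _ _).1.
  exact: diff_derivable.
apply: cvg_lim => //.
evar (k : R -> V); rewrite [X in X @ _](_ : _ = k); last first.
  rewrite funeqE => h /=.
  have -> : f (h *: v + x) *: F (h *: v + x) - f x *: F x =
    f x *: (F (h *: v + x) - F x) + (f (h *: v + x) - f x) *: F (h *: v + x).
    by rewrite scalerBr scalerBl [RHS]addrC subrKA.
  rewrite scalerDr scalerA mulrC -scalerA [X in _ + X]scalerA /k; reflexivity.
apply: cvgD; first by apply: cvgZl_tmp; exact: diff_derivable.
apply: cvgZ; first exact: (@diff_derivable _ _ _ f).
by move/continuous_withinNx : cF; rewrite scale0r add0r.
Qed.

Lemma derive_comp (W : normedModType R) (G : W -> U) F (y v : W) :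
  differentiable G y -> differentiable F (G y) ->
  'D_v (F \o G) y = 'D_('D_v G y) F (G y).
Proof.
move=> dG dF; rewrite (deriveE _ (differentiable_comp dG dF)) diff_comp //.
by rewrite (deriveE _ dG) (deriveE _ dF).
Qed.

Lemma derive_line F x v (t : R) : differentiable F (t *: v + x) ->
  is_derive t 1 (fun h : R => F (h *: v + x)) ('D_v F (t *: v + x)).
Proof.
move=> dF; have dl : is_diff t (fun h : R => h *: v + x) (fun h => h *: v).
  have -> : (fun h : R => h *: v + x) = *:%R ^~ v + cst x by [].
  by apply: is_diff_eq; rewrite addr0.
have dL : differentiable (fun h : R => h *: v + x) t by exact: ex_diff.
split; first by apply: diff_derivable; exact: differentiable_comp.
rewrite (derive_comp (G := fun h : R => h *: v + x)) //.
by rewrite (deriveE _ dL) diff_val scale1r.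
Qed.

End Differentiability.

Section Schwarz.
Variables (R : realType) (U : normedModType R).
Implicit Types (f : U -> R^o) (x v w : U).

Lemma line_MVT f x v (h : R) : 0 < h ->
  (forall t : R, 0 <= t <= h -> differentiable f (t *: v + x)) ->
  exists2 c : R, 0 < c < h & f (h *: v + x) - f x = h * 'D_v f (c *: v + x).
Proof.
move=> h0 df.
have [||c ch] := @MVT R (fun t => f (t *: v + x)) (fun t => 'D_v f (t *: v + x)) 0 h h0.
- move=> t; rewrite in_itv /= => /andP[t0 th]; have tP : 0 <= t <= h by rewrite !ltW.
  exact: (derive_line (df t tP)).
- have df' z : z \in `[0, h] -> derivable (fun t : R => f (t *: v + x)) z 1.
    by rewrite in_itv /= => zh; have [] := derive_line (df z zh).
  exact: (derivable_within_continuous df').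
- rewrite scale0r add0r subr0 => ->; exists c; first by rewrite in_itv in ch.
  by rewrite mulrC.
Qed.

(** The mean value theorem is applied twice: to [z |-> f (h *: w + z) - f z] along [v], then to the
    [v]-derivative along [w]. The left-hand side is symmetric in [v] and [w], which is what yields
    the symmetry of second derivatives. *)
Lemma second_difference f x v w (h : R) : 0 < h ->
  (forall s t : R, 0 <= s <= h -> 0 <= t <= h ->
    differentiable f (s *: v + t *: w + x) /\
    differentiable (fun z => 'D_v f z : R^o) (s *: v + t *: w + x)) ->
  exists2 cd : R * R, 0 < cd.1 < h /\ 0 < cd.2 < h &
    f (h *: v + h *: w + x) - f (h *: v + x) - f (h *: w + x) + f x =
    h ^+ 2 * 'D_w (fun z => 'D_v f z : R^o) (cd.1 *: v + cd.2 *: w + x).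
Proof.
move=> h0 df.
have hh : 0 <= h <= h by rewrite lexx ltW.
have oh : (0 : R) <= 0 <= h by rewrite lexx ltW.
have dsh z : differentiable (fun z => h *: w + z) z.
  exact: (differentiableD (differentiable_cst (h *: w) z) (ex_diff (df := id))).
have dg s : 0 <= s <= h -> differentiable (fun z => f (h *: w + z)) (s *: v + x).
  move=> sh; apply: (@differentiable_comp _ _ _ _ (fun z => h *: w + z) f) => //.
  by have [] := df _ _ sh hh; rewrite addrAC addrC.
have df0 s : 0 <= s <= h -> differentiable f (s *: v + x).
  by move=> sh; have [] := df _ _ sh oh; rewrite scale0r addr0.
have [c ch E] := @line_MVT (fun z => f (h *: w + z) - f z) x v h h0
  (fun s sh => differentiableB (dg s sh) (df0 s sh)).
have ch' : 0 <= c <= h by case/andP: ch => ? ?; rewrite !ltW.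
have [t th|d dh E2] := @line_MVT (fun z => 'D_v f z : R^o) (c *: v + x) w h h0.
  by have [] := df _ _ ch' th; rewrite addrAC addrC.
exists (c, d); first by split.
rewrite /=.
have -> : f (h *: v + h *: w + x) - f (h *: v + x) - f (h *: w + x) + f x =
  f (h *: w + (h *: v + x)) - f (h *: v + x) - (f (h *: w + x) - f x).
  by rewrite addrA [h *: w + h *: v]addrC opprB addrA; ring.
rewrite E.
rewrite (deriveB (diff_derivable (dg _ ch')) (diff_derivable (df0 _ ch'))).
have dfc : differentiable f (h *: w + (c *: v + x)).
  by have [] := df _ _ ch' hh; rewrite addrAC addrC.
rewrite (derive_comp (F := f) _ (dsh _) dfc).
have -> : 'D_v (fun z => h *: w + z) (c *: v + x) = v.
  rewrite (@deriveD _ _ _ (cst (h *: w)) id); [|exact: derivable_cst|exact: derivable_id].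
  by rewrite derive_cst derive_id add0r.
have Ev : d *: w + (c *: v + x) = c *: v + d *: w + x.
  by rewrite addrA (addrC (d *: w)).
rewrite Ev in E2; apply: etrans (congr1 (fun a : R => h * a) E2) _.
exact: mulrA.
Qed.

(** The two orders of the mean value argument produce different intermediate points, so the mixed
    derivatives agree only at two points near [x]. Continuity at [x] removes the discrepancy as [h]
    tends to 0; [D] is the neighbourhood on which the parallelogram must lie for the mean value
    theorem to apply. *)
Lemma eq_at_common_limit (A B : U -> R^o) x v w (D : set U) : nbhs x D ->
  {for x, continuous A} -> {for x, continuous B} ->
  (forall h : R, 0 < h ->
    (forall s t : R, 0 <= s <= h -> 0 <= t <= h -> D (s *: v + t *: w + x)) ->
    exists c d c' d' : R, [/\ 0 < c < h, 0 < d < h, 0 < c' < h, 0 < d' < h &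
      A (c *: v + d *: w + x) = B (d' *: v + c' *: w + x)]) ->
  A x = B x.
Proof.
move=> nD /cvgrPdist_lt cA /cvgrPdist_lt cB AB.
apply/eqP; rewrite -subr_eq0 -normr_le0; apply/ler_addgt0Pr => e e0; rewrite add0r.
have e20 : 0 < e / 2 by rewrite divr_gt0.
pose NA := [set z | `|A x - A z| < e / 2].
pose NB := [set z | `|B x - B z| < e / 2].
have nA : nbhs x NA by exact: (cA _ e20).
have nB : nbhs x NB by exact: (cB _ e20).
have /nbhs_ballP[r /= r0 br] : nbhs x (D `&` (NA `&` NB)).
  by apply: filterI => //; exact: filterI.
have [h h0 bh] : exists2 h : R, 0 < h & forall s t : R,
    0 <= s <= h -> 0 <= t <= h -> ball x r (s *: v + t *: w + x).
  have vw0 : 0 < `|v| + `|w| + 1 by rewrite ltr_wpDl // addr_ge0.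
  (* The summand 1 keeps the denominator positive when [v] and [w] vanish and makes the final
     estimate strict. *)
  have h0 : 0 < r / (`|v| + `|w| + 1) by rewrite divr_gt0.
  exists (r / (`|v| + `|w| + 1)) => // s t /andP[s0 sh] /andP[t0 th].
  rewrite -ball_normE /= opprD addrCA subrr addr0 normrN.
  apply: le_lt_trans (ler_normD _ _) _; rewrite !normrZ !ger0_norm //.
  rewrite -[ltRHS](mulfVK (lt0r_neq0 vw0)) !mulrDr mulr1.
  apply: (@le_lt_trans _ _
    (r / (`|v| + `|w| + 1) * `|v| + r / (`|v| + `|w| + 1) * `|w|)).
    by apply: lerD; rewrite ler_wpM2r.
  by rewrite ltrDl.
have [|c [d [c' [d' [c0 d0 c'0 d'0 E]]]]] := AB h h0.
  by move=> s t sh th; have [] := br _ (bh s t sh th).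
have lt_le (a : R) : 0 < a < h -> 0 <= a <= h by case/andP => ? ?; rewrite !ltW.
have [_ [+ _]] := br _ (bh c d (lt_le _ c0) (lt_le _ d0)).
have [_ [_ +]] := br _ (bh d' c' (lt_le _ d'0) (lt_le _ c'0)).
rewrite /NA /NB /= E distrC => n1 n2.
rewrite (splitr e); apply/ltW; apply: le_lt_trans (ltrD n2 n1).
exact: ler_distD.
Qed.

Lemma schwarz f x v w :
  (\near x, differentiable f x) ->
  (\near x, differentiable (fun z => 'D_v f z : R^o) x) ->
  (\near x, differentiable (fun z => 'D_w f z : R^o) x) ->
  {for x, continuous (fun z => 'D_w (fun z => 'D_v f z : R^o) z : R^o)} ->
  {for x, continuous (fun z => 'D_v (fun z => 'D_w f z : R^o) z : R^o)} ->
  'D_w (fun z => 'D_v f z : R^o) x = 'D_v (fun z => 'D_w f z : R^o) x.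
Proof.
move=> df dvf dwf cwv cvw.
pose D := [set z | differentiable f z] `&`
  ([set z | differentiable (fun z => 'D_v f z : R^o) z] `&`
   [set z | differentiable (fun z => 'D_w f z : R^o) z]).
have nD : nbhs x D by apply: filterI; [exact: df | exact: filterI].
apply: (@eq_at_common_limit _ _ x v w D nD cwv cvw) => h h0 dh.
have [|[c d] /= [c0 d0] E1] := @second_difference f x v w h h0.
  by move=> s t sh th; have [? [? ?]] := dh s t sh th.
have [|[c' d'] /= [c'0 d'0] E2] := @second_difference f x w v h h0.
  by move=> s t sh th; have [? [? ?]] := dh t s th sh; rewrite (addrC (s *: w)).
exists c, d, c', d'; split; [exact: c0|exact: d0|exact: c'0|exact: d'0|].
have h20 : h ^+ 2 != 0 by rewrite expf_neq0 // gt_eqF.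
apply: (mulfI h20); rewrite (addrC (d' *: v)); apply: etrans (esym E1) (etrans _ E2).
by rewrite (addrC (h *: w) (h *: v)) -!addrA; congr (_ + _); rewrite addrCA.
Qed.

End Schwarz.

(** * Closure properties of C^k maps *)

Section CkTheory.
Variables (R : realType) (m : nat).
Implicit Types (V : normedModType R) (U : set 'rV[R]_m).

Lemma Ck_eq V k U (F G : 'rV[R]_m -> V) : open U ->
  (forall y, U y -> F y = G y) -> Ck k U F -> Ck k U G.
Proof.
move=> oU; elim: k F G => [|k IH] F G FG /=.
  move=> cF y Uy.
  by apply: near_eq_continuous (cF y Uy); apply: filterS (open_nbhs_nbhs (conj oU Uy)).
have nFG y : U y -> {near y, F =1 G}.
  by move=> Uy; apply: filterS (open_nbhs_nbhs (conj oU Uy)).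
move=> [dF DF]; split=> [y Uy|v]; first by have [] := near_eq_diff (nFG y Uy) (dF y Uy).
by apply: IH (DF v) => y Uy; apply: near_eq_derive; exact: nFG.
Qed.

Lemma Ck_sub V k U U' (F : 'rV[R]_m -> V) : U' `<=` U -> Ck k U F -> Ck k U' F.
Proof.
move=> sU; elim: k F => [|k IH] F /=; first by move=> cF y /sU; exact: cF.
by move=> [dF DF]; split=> [y /sU|v]; [exact: dF | exact: IH].
Qed.

Lemma CkS V k U (F : 'rV[R]_m -> V) : Ck k.+1 U F -> Ck k U F.
Proof.
elim: k F => [|k IH] F.
  by move=> [dF _] y Uy; apply: differentiable_continuous; exact: dF.
by move=> [dF DF]; split=> // v; apply: IH; exact: DF.
Qed.

Lemma Ck_cst V k U (w : V) : Ck k U (fun=> w).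
Proof.
elim: k w => [|k IH] w /=; first by move=> y _; exact: (@cst_continuous _ _ w).
split=> [y _|v]; first exact: (differentiable_cst w).
rewrite [X in Ck _ _ X](_ : _ = fun=> 0); first exact: IH.
by apply/funext => y; exact: (derive_cst w).
Qed.

Lemma CkD V k U (F G : 'rV[R]_m -> V) : open U ->
  Ck k U F -> Ck k U G -> Ck k U (fun y => F y + G y).
Proof.
move=> oU; elim: k F G => [|k IH] F G /=.
  by move=> cF cG y Uy; exact: (cvgD (cF y Uy) (cG y Uy)).
move=> [dF DF] [dG DG]; split=> [y Uy|v].
  by apply: (differentiableD (f := F)); [exact: dF | exact: dG].
apply: Ck_eq (IH _ _ (DF v) (DG v)) => // y Uy.
by rewrite -deriveD //; apply: diff_derivable; [exact: dF | exact: dG].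
Qed.

Lemma CkZ V k U (f : 'rV[R]_m -> R^o) (F : 'rV[R]_m -> V) : open U ->
  Ck k U f -> Ck k U F -> Ck k U (fun y => f y *: F y).
Proof.
move=> oU; elim: k f F => [|k IH] f F.
  by move=> cf cF y Uy; exact: (cvgZ (cf y Uy) (cF y Uy)).
move=> /[dup] /CkS cf [df Df] /[dup] /CkS cF [dF DF]; split=> [y Uy|v].
  by apply: scale_differentiable; [exact: df | exact: dF].
have cfF := CkD oU (IH _ _ cf (DF v)) (IH _ _ (Df v) cF).
apply: Ck_eq cfF => // y Uy.
by rewrite derive_scale //; [exact: df | exact: dF].
Qed.

Lemma Ck_sum V k U (I : Type) (r : seq I) (F : I -> 'rV[R]_m -> V) : open U ->
  (forall i, Ck k U (F i)) -> Ck k U (fun y => \sum_(i <- r) F i y).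
Proof.
move=> oU cF; elim: r => [|i r IH].
  by under eq_fun do rewrite big_nil; exact: Ck_cst.
by under eq_fun do rewrite big_cons; exact: CkD.
Qed.

Lemma Ck_lin V (W : normedModType R) k U (L : {linear V -> W}) (F : 'rV[R]_m -> V) :
  open U -> continuous L -> Ck k U F -> Ck k U (L \o F).
Proof.
move=> oU cL; elim: k F => [|k IH] F.
  by move=> cF y Uy; apply: continuous_comp; [exact: cF | exact: cL].
move=> [dF DF]; split=> [y Uy|v].
  by apply: differentiable_comp; [exact: dF | exact: linear_differentiable].
apply: Ck_eq (IH _ (DF v)) => // y Uy /=.
have dL : differentiable L (F y) by exact: linear_differentiable.
rewrite (deriveE _ (dF y Uy)) deriveE; last exact: differentiable_comp (dF y Uy) dL.
by rewrite (diff_comp (dF y Uy) dL) /= (diff_lin _ cL).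
Qed.

Lemma derive_row_sum n V (F : 'rV[R]_n -> V) y v : differentiable F y ->
  'D_v F y = \sum_(i < n) v 0 i *: 'D_(delta_mx 0 i) F y.
Proof.
move=> dF; rewrite (deriveE _ dF) [in LHS](row_sum_delta v) linear_sum.
by apply: eq_bigr => i _; rewrite linearZ /= (deriveE _ dF).
Qed.

Lemma Ck_coord n k U (F : 'rV[R]_m -> 'rV[R]_n) i : open U ->
  Ck k U F -> Ck k U (fun y => F y 0 i : R^o).
Proof.
move=> oU cF.
have @L : {linear 'rV[R]_n -> R^o}.
  by exists (fun N : 'rV[R]_n => N 0 i); do 2![eexists]; do ?[constructor];
     rewrite ?mxE// => ? *; rewrite ?mxE//; move=> ?; rewrite !mxE.
apply: (Ck_lin (L := L)) => // M; exact: coord_continuous.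
Qed.

(** By the chain rule the derivative of [F] is taken in the direction ['D_v G y], which varies with
    [y], whereas [Ck] speaks of fixed directions. Expanding that direction in the standard basis
    turns the derivative into a sum of products covered by the induction hypothesis. *)
Lemma Ck_comp V n k U (U' : set 'rV[R]_n) (G : 'rV[R]_m -> 'rV[R]_n)
    (F : 'rV[R]_n -> V) : open U -> (forall y, U y -> U' (G y)) ->
  Ck k U G -> Ck k U' F -> Ck k U (F \o G).
Proof.
move=> oU GU; elim: k F => [|k IH] F.
  move=> cG cF y Uy; apply: continuous_comp; first exact: cG.
  by apply: cF; exact: GU.
move=> /[dup] /CkS cG [dG DG] [dF DF]; split=> [y Uy|v].
  by apply: differentiable_comp; [exact: dG | apply: dF; exact: GU].
have cDF i : Ck k U (fun y => ('D_v G y 0 i : R^o) *: 'D_(delta_mx 0 i) F (G y)).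
  apply: CkZ => //; first exact: (Ck_coord i oU (DG v)).
  exact: (IH (fun z => 'D_(delta_mx 0 i) F z) cG (DF _)).
apply: Ck_eq (Ck_sum (index_enum 'I_n) oU cDF) => // y Uy.
have dFy : differentiable F (G y) by apply: dF; exact: GU.
by rewrite (derive_comp _ (dG y Uy) dFy) (derive_row_sum _ dFy).
Qed.

End CkTheory.

(** * Smooth functions and vector fields in charts *)

Section Charts.
Variables (R : realType) (m : nat) (M : smoothManifold R m).
Implicit Types (p q r : M) (W : set M) (X Y Z : vfield M) (f : M -> R).

Definition chart_image p W : set 'rV[R]_m := chart p @` (dom p `&` W).

Lemma chart_imageP p W y : chart_image p W y ->
  [/\ dom p (ichart p y), W (ichart p y) & chart p (ichart p y) = y].
Proof. by case=> q [pq Wq] <-; rewrite chartK. Qed.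

Lemma mem_chart_image p q W : dom p q -> W q -> chart_image p W (chart p q).
Proof. by move=> pq Wq; exists q. Qed.

Lemma sub_chart_image p W W' : W `<=` W' -> chart_image p W `<=` chart_image p W'.
Proof. by move=> WW' y [q [pq /WW' Wq] <-]; exists q. Qed.

Lemma open_chart_image p W : open W -> open (chart_image p W).
Proof.
move=> oW; rewrite openE => y /[dup] /chart_imageP[py Wy yE] [q [pq Wq] qE].
have cy : (chart p @` dom p) y by exists q.
have n1 : nbhs y (chart p @` dom p).
  by apply: open_nbhs_nbhs; split=> //; exact: chart_open.
have n2 : nbhs y (ichart p @^-1` W).
  by apply: (ichart_continuous cy); exact: open_nbhs_nbhs.
apply: filterS (filterI n1 n2) => z [[q' pq' <-]] /=.
by rewrite chartK // => Wq'; exists q'.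
Qed.

Arguments open_chart_image p [W].

Lemma nbhs_chart_image p q W : open W -> dom p q -> W q ->
  nbhs (chart p q) (chart_image p W).
Proof.
move=> oW pq Wq; apply: open_nbhs_nbhs; split; first exact: open_chart_image.
exact: mem_chart_image.
Qed.

Lemma transition_differentiable p q r : dom p r -> dom q r ->
  differentiable (chart q \o ichart p) (chart p r).
Proof.
move=> pr qr; have [dT _] := transition_smooth p q 1.
by apply: dT; exact: mem_chart_image.
Qed.

Lemma coord_change_id p r x : dom p r -> coord_change p p r x = x.
Proof.
move=> pr; rewrite /coord_change.
have [|_ ->] := @near_eq_diff R _ _ idfun (chart p \o ichart p) (chart p r) _
  (ex_diff (df := idfun)).
  apply: filterS (nbhs_chart_image (dom_open p) pr pr) => y.
  by move=> /chart_imageP[_ _].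
by rewrite (diff_val (df := idfun)).
Qed.

Lemma coord_change_comp p q s r x : dom p r -> dom q r -> dom s r ->
  coord_change q s r (coord_change p q r x) = coord_change p s r x.
Proof.
move=> pr qr sr; rewrite /coord_change.
have d1 := transition_differentiable pr qr.
have d2 : differentiable (chart s \o ichart q) ((chart q \o ichart p) (chart p r)).
  by rewrite /= chartK //; exact: transition_differentiable.
have dc : differentiable ((chart s \o ichart q) \o (chart q \o ichart p)) (chart p r).
  exact: (differentiable_comp d1 d2).
have nE : {near chart p r,
    (chart s \o ichart q) \o (chart q \o ichart p) =1 chart s \o ichart p}.
  apply: filterS (nbhs_chart_image (dom_open q) pr qr) => y.
  by move=> /chart_imageP[_ qy _]; rewrite /= chartK.
have [_ dE] := near_eq_diff nE dc.
apply: esym; apply: etrans (congr1 (fun F => F x) dE) _.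
apply: etrans (congr1 (fun F => F x) (diff_comp d1 d2)) _.
by rewrite /= chartK.
Qed.

Lemma vfield_in_chartE p q X : dom p q ->
  vfield_in_chart p X (chart p q) = coord_change q p q (X q).
Proof. by move=> pq; rewrite /vfield_in_chart chartK. Qed.

Lemma vfield_in_chart_center p X : vfield_in_chart p X (chart p p) = X p.
Proof. by rewrite vfield_in_chartE ?coord_change_id //; exact: dom_self. Qed.

Lemma smooth_fun_eq W f f' : open W -> {in W, f =1 f'} ->
  smooth_fun W f -> smooth_fun W f'.
Proof.
move=> oW ff' sf p k; apply: Ck_eq (sf p k); first exact: open_chart_image.
by move=> y /chart_imageP[_ Wy _]; rewrite /= ff' // inE.
Qed.

Lemma smooth_vfield_eq W X Y : open W -> {in W, X =1 Y} ->
  smooth_vfield W X -> smooth_vfield W Y.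
Proof.
move=> oW XY sX p k; apply: Ck_eq (sX p k); first exact: open_chart_image.
by move=> y /chart_imageP[_ Wy _]; rewrite /vfield_in_chart XY // inE.
Qed.

Lemma smooth_fun_sub W W' f : W' `<=` W -> smooth_fun W f -> smooth_fun W' f.
Proof. by move=> sW sf p k; apply: Ck_sub (sf p k); exact: sub_chart_image. Qed.

Lemma smooth_vfield_sub W W' X : W' `<=` W -> smooth_vfield W X -> smooth_vfield W' X.
Proof. by move=> sW sX p k; apply: Ck_sub (sX p k); exact: sub_chart_image. Qed.

Lemma smooth_fun_cst W (a : R) : smooth_fun W (fun=> a).
Proof. by move=> p k; exact: (Ck_cst k _ (a : R^o)). Qed.

Lemma smooth_funB W f f' : open W -> smooth_fun W f -> smooth_fun W f' ->
  smooth_fun W (fun q => f q - f' q).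
Proof.
move=> oW sf sf' p k; have oP := open_chart_image p oW.
have c1 : Ck k (chart_image p W) (fun=> -1 : R^o) by exact: Ck_cst.
apply: Ck_eq (CkD oP (sf p k) (CkZ oP c1 (sf' p k))) => // y _.
by rewrite scaleN1r.
Qed.

Lemma smooth_vfieldZ W f X : open W -> smooth_fun W f -> smooth_vfield W X ->
  smooth_vfield W (fun q => f q *: X q).
Proof.
move=> oW sf sX p k; have oP := open_chart_image p oW.
apply: Ck_eq (CkZ oP (sf p k) (sX p k)) => // y _.
by rewrite /vfield_in_chart /coord_change linearZ.
Qed.

Lemma smooth_vfieldD W X Y : open W -> smooth_vfield W X -> smooth_vfield W Y ->
  smooth_vfield W (fun q => X q + Y q).
Proof.
move=> oW sX sY p k; have oP := open_chart_image p oW.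
apply: Ck_eq (CkD oP (sX p k) (sY p k)) => // y _.
by rewrite /vfield_in_chart /coord_change linearD.
Qed.

Lemma smooth_vfield0 W : smooth_vfield W (fun=> 0).
Proof.
move=> p k; rewrite (_ : vfield_in_chart p _ = fun=> 0); first exact: Ck_cst.
by apply/funext => y; rewrite /vfield_in_chart /coord_change linear0.
Qed.

Lemma smooth_vfieldN W X : open W -> smooth_vfield W X ->
  smooth_vfield W (fun q => - X q).
Proof.
have s1 := smooth_fun_cst W (-1).
move=> oW sX; apply: smooth_vfield_eq (smooth_vfieldZ oW s1 sX) => //.
by move=> q _; rewrite scaleN1r.
Qed.

Lemma smooth_vfieldB W X Y : open W -> smooth_vfield W X -> smooth_vfield W Y ->
  smooth_vfield W (fun q => X q - Y q).
Proof. by move=> oW sX sY; exact: smooth_vfieldD (smooth_vfieldN oW sY). Qed.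

Lemma smooth_vfield_sum W (I : Type) (l : seq I) (F : I -> vfield M) : open W ->
  (forall i, smooth_vfield W (F i)) ->
  smooth_vfield W (fun q => \sum_(i <- l) F i q).
Proof.
move=> oW sF; elim: l => [|i l IH].
  by under eq_fun do rewrite big_nil; exact: smooth_vfield0.
by under eq_fun do rewrite big_cons; exact: smooth_vfieldD.
Qed.

(** Read in the chart at [r], the field is the derivative in the fixed direction [x] of the
    transition map from [p] to [r], composed with the inverse transition. One order of
    differentiability is lost, hence [k.+1]. *)
Lemma smooth_const_extension p x : smooth_vfield (dom p) (const_extension p x).
Proof.
move=> r k; have oP := open_chart_image r (dom_open p).
have [_ DT] := transition_smooth p r k.+1.
apply: Ck_eq (Ck_comp oP _ (transition_smooth r p k) (DT x)) => //.
  move=> y /chart_imageP[ry py yE].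
  rewrite /= /vfield_in_chart /const_extension.
  rewrite coord_change_comp //; last exact: dom_self.
  by rewrite (deriveE _ (transition_differentiable py ry)).
by move=> y /chart_imageP[ry py yE]; exact: mem_chart_image.
Qed.

Lemma const_extension_center p x : const_extension p x p = x.
Proof. by rewrite /const_extension coord_change_id //; exact: dom_self. Qed.

Definition component p X i : M -> R := fun q => coord_change q p q (X q) 0 i.

Lemma component_sum p X q : dom p q ->
  X q = \sum_i component p X i q *: const_extension p (delta_mx 0 i) q.
Proof.
move=> pq; rewrite -[LHS](coord_change_id (X q) (dom_self q)).
rewrite -(coord_change_comp _ (dom_self q) pq (dom_self q)).
rewrite [in LHS](row_sum_delta (coord_change q p q (X q))).
rewrite {1}/coord_change linear_sum; apply: eq_bigr => i _; exact: linearZ.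
Qed.

Lemma smooth_component W p X i : open W -> W `<=` dom p -> smooth_vfield W X ->
  smooth_fun W (component p X i).
Proof.
move=> oW Wp sX r k; have oP := open_chart_image r oW.
have sP : chart_image r W `<=` chart_image r (dom p) by exact: sub_chart_image.
have [dT DT] := transition_smooth r p k.+1.
pose F j y := (vfield_in_chart r X y 0 j : R^o) *:
  'D_(delta_mx 0 j) (chart p \o ichart r) y.
have cF j : Ck k (chart_image r W) (F j).
  by apply: CkZ => //; [exact: Ck_coord (sX r k) | exact: Ck_sub (DT _)].
apply: Ck_eq (Ck_coord i oP (Ck_sum (index_enum 'I_m) oP cF)) => // y Wy.
have [ry {}Wy yE] := chart_imageP Wy; have py := Wp _ Wy.
have dTy : differentiable (chart p \o ichart r) y.
  by rewrite -yE; exact: transition_differentiable.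
rewrite /F -(derive_row_sum _ dTy) (deriveE _ dTy) /component /=; congr (_ 0 i).
by rewrite -(coord_change_comp _ (dom_self _) ry py) /coord_change yE.
Qed.

Lemma smooth_chart_coord p i : smooth_fun (dom p) (fun q => chart p q 0 i).
Proof.
move=> r k; have oP := open_chart_image r (dom_open p).
exact: Ck_coord (transition_smooth r p k).
Qed.

(** [vderive] uses the distinguished chart of the point, which changes with the point. A fixed chart
    [r] is what allows [vderive X f] to be differentiated again. *)
Lemma vderive_chart W r q X f : open W -> smooth_fun W f -> dom r q -> W q ->
  vderive X f q =
  'D_(vfield_in_chart r X (chart r q)) (f \o ichart r : _ -> R^o) (chart r q).
Proof.
move=> oW sf rq Wq; have qq := dom_self q.
have dT := transition_differentiable qq rq.
have dF : differentiable (f \o ichart r : _ -> R^o) ((chart r \o ichart q) (chart q q)).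
  rewrite /= chartK //; have [dF _] := sf r 1.
  by apply: dF; exact: mem_chart_image.
rewrite vfield_in_chartE // /coord_change -(deriveE _ dT).
have cE := derive_comp (X q) dT dF.
rewrite [X in _ = 'D_ _ _ X](_ : _ = (chart r \o ichart q) (chart q q)); last first.
  by rewrite /= chartK.
apply: etrans cE; apply: near_eq_derive.
apply: filterS (nbhs_chart_image (dom_open r) qq rq) => y.
by move=> /chart_imageP[_ ry _]; rewrite /= chartK.
Qed.

Lemma smooth_vderive W X f : open W -> smooth_vfield W X -> smooth_fun W f ->
  smooth_fun W (vderive X f).
Proof.
move=> oW sX sf r k; have oP := open_chart_image r oW.
have [dF DF] := sf r k.+1.
pose F j y := (vfield_in_chart r X y 0 j : R^o) *:
  'D_(delta_mx 0 j) (f \o ichart r : _ -> R^o) y.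
have cF j : Ck k (chart_image r W) (F j).
  by apply: CkZ => //; [exact: Ck_coord (sX r k) | exact: DF].
apply: Ck_eq (Ck_sum (index_enum 'I_m) oP cF) => // y Wy.
have [ry {}Wq yE] := chart_imageP Wy.
by rewrite /= (vderive_chart X oW sf ry Wq) yE [in RHS](derive_row_sum _ (dF y Wy)).
Qed.

Lemma vderive_eq W X f f' p : open W -> W p -> {in W, f =1 f'} ->
  vderive X f p = vderive X f' p.
Proof.
move=> oW Wp ff'; apply: near_eq_derive.
apply: filterS (nbhs_chart_image oW (dom_self p) Wp) => y.
by move=> /chart_imageP[_ Wy _] /=; rewrite ff' // inE.
Qed.

Lemma smooth_fun_differentiable W f p : smooth_fun W f -> W p ->
  differentiable (f \o ichart p : _ -> R^o) (chart p p).
Proof.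
move=> sf Wp; have [dF _] := sf p 1; apply: dF.
by apply: mem_chart_image => //; exact: dom_self.
Qed.

Lemma vderive_cst X (a : R) p : vderive X (fun=> a) p = 0.
Proof. exact: (derive_cst (a : R^o)). Qed.

Lemma vderiveZ W X f (a : R) p : smooth_fun W f -> W p ->
  vderive X (fun q => a * f q) p = a * vderive X f p.
Proof.
move=> sf Wp; have df := diff_derivable (v := X p) (smooth_fun_differentiable sf Wp).
exact: (deriveZ a df).
Qed.

Lemma vderiveD W X f f' p : smooth_fun W f -> smooth_fun W f' -> W p ->
  vderive X (fun q => f q + f' q) p = vderive X f p + vderive X f' p.
Proof.
move=> sf sf' Wp.
have df := diff_derivable (v := X p) (smooth_fun_differentiable sf Wp).
have df' := diff_derivable (v := X p) (smooth_fun_differentiable sf' Wp).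
exact: (deriveD df df').
Qed.

Lemma vderiveB W X f f' p : smooth_fun W f -> smooth_fun W f' -> W p ->
  vderive X (fun q => f q - f' q) p = vderive X f p - vderive X f' p.
Proof.
move=> sf sf' Wp.
have df := diff_derivable (v := X p) (smooth_fun_differentiable sf Wp).
have df' := diff_derivable (v := X p) (smooth_fun_differentiable sf' Wp).
exact: (deriveB df df').
Qed.

Lemma vderiveBl W X Y f p : smooth_fun W f -> W p ->
  vderive (fun q => X q - Y q) f p = vderive X f p - vderive Y f p.
Proof.
move=> sf Wp; have df := smooth_fun_differentiable sf Wp.
by rewrite /vderive !(deriveE _ df) linearB.
Qed.

(** In the chart at [p], [X (Y f)] is a second derivative of [f] plus the derivative of [f] along
    the derivative of the components of [Y]. The second-order parts cancel by [schwarz], and the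
    rest is the coordinate formula defining [bracket]. *)
Lemma vderive_bracket W X Y f p : open W -> smooth_vfield W X ->
  smooth_vfield W Y -> smooth_fun W f -> W p ->
  vderive (bracket X Y) f p =
  vderive X (vderive Y f) p - vderive Y (vderive X f) p.
Proof.
move=> oW sX sY sf Wp; set F := f \o ichart p : _ -> R^o; set y0 := chart p p.
have oP := open_chart_image p oW.
have Uy0 : chart_image p W y0 by apply: mem_chart_image => //; exact: dom_self.
have nU := open_nbhs_nbhs (conj oP Uy0).
have dF y : chart_image p W y -> differentiable F y by have [dF _] := sf p 1; exact: dF.
have dDF v y : chart_image p W y -> differentiable ('D_v F) y.
  by have [_ /(_ v) [dDF _]] := sf p 2; exact: dDF.
have cDDF v w : {for y0, continuous ('D_w ('D_v F))}.
  by have [_ /(_ v) [_ /(_ w) cF]] := sf p 2; exact: cF.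
have sch v w : 'D_w ('D_v F) y0 = 'D_v ('D_w F) y0.
  apply: (schwarz (f := F)); [| | |exact: (cDDF v w)|exact: (cDDF w v)].
  - by apply: filterS nU => y Uy; exact: dF.
  - by apply: filterS nU => y Uy; exact: dDF.
  - by apply: filterS nU => y Uy; exact: dDF.
have main A B : smooth_vfield W A -> smooth_vfield W B ->
    vderive A (vderive B f) p =
    'D_(B p) ('D_(A p) F) y0 + 'D_('D_(A p) (vfield_in_chart p B) y0) F y0.
  move=> sA sB; have [dB _] := sB p 1; have dBy := dB _ Uy0.
  pose b i y : R^o := vfield_in_chart p B y 0 i.
  have db i : differentiable (b i) y0.
    exact: (differentiable_comp dBy (differentiable_coord _ 0 i)).
  have Db v i : 'D_v (b i) y0 = ('D_v (vfield_in_chart p B) y0) 0 i.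
    by rewrite (derive_mx (diff_derivable (v := v) dBy)) mxE.
  have -> : vderive A (vderive B f) p =
      'D_(A p) (fun y => \sum_i b i y *: 'D_(delta_mx 0 i) F y) y0.
    apply: near_eq_derive; apply: filterS nU => y Uy.
    have [py Wy yE] := chart_imageP Uy.
    by rewrite /= (vderive_chart B oW sf py Wy) yE (derive_row_sum _ (dF y Uy)).
  pose h i y : R^o := b i y *: 'D_(delta_mx 0 i) F y.
  have dh i : derivable (h i) y0 (A p).
    by apply: diff_derivable; apply: scale_differentiable; [exact: db | exact: dDF].
  have -> : (fun y => \sum_i b i y *: 'D_(delta_mx 0 i) F y) = \sum_(i < m) h i.
    by apply/funext => y; rewrite fct_sumE.
  rewrite (derive_sum dh) (derive_row_sum (B p) (dDF (A p) y0 Uy0)).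
  rewrite (derive_row_sum ('D_(A p) _ y0) (dF y0 Uy0)) -big_split /=.
  apply: eq_bigr => i _; rewrite (derive_scale (A p) (db i) (dDF _ _ Uy0)) Db.
  have Bc : b i y0 = B p 0 i.
    exact: (congr1 (fun u : 'rV[R]_m => u 0 i) (vfield_in_chart_center p B)).
  rewrite Bc; apply: (congr1 (fun t : R^o => t + _)).
  exact: (congr1 (fun t : R^o => B p 0 i *: t) (sch _ _)).
rewrite (main X Y sX sY) (main Y X sY sX) (sch (X p) (Y p)).
rewrite opprD addrACA subrr add0r /vderive /bracket -/F -/y0.
by rewrite !(deriveE _ (dF y0 Uy0)) linearB.
Qed.

(** The coordinate functions of the chart at [p] suffice as test functions. They are smooth only on
    [dom p], which is why the test functions live on the intersection. *)
Lemma vfield_ext W X Y p : open W -> W p ->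
  (forall f, smooth_fun (W `&` dom p) f -> vderive X f p = vderive Y f p) ->
  X p = Y p.
Proof.
move=> oW Wp XY; apply/rowP => i.
have sW : W `&` dom p `<=` dom p by exact: subIsetr.
have := XY _ (smooth_fun_sub sW (smooth_chart_coord p i)).
suff E Z : vderive Z (fun q => chart p q 0 i) p = Z p 0 i by rewrite !E.
have -> : vderive Z (fun q => chart p q 0 i) p =
    'D_(Z p) (fun y : 'rV[R]_m => y 0 i : R^o) (chart p p).
  have nP := nbhs_chart_image (dom_open p) (dom_self p) (dom_self p).
  apply: near_eq_derive; apply: filterS nP => y.
  by move=> /chart_imageP[_ _ /= ->].
have did : differentiable (id : 'rV[R]_m -> 'rV[R]_m) (chart p p) by exact: ex_diff.
have := derive_mx (diff_derivable (v := Z p) did).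
by rewrite derive_id => /rowP/(_ i); rewrite mxE => ->.
Qed.

Lemma bracket0l Y p : bracket (fun=> 0) Y p = 0.
Proof.
rewrite /bracket derive0 sub0r (_ : vfield_in_chart p _ = fun=> 0).
  by rewrite (derive_cst (0 : 'rV[R]_m)) oppr0.
by apply/funext => y; rewrite /vfield_in_chart /coord_change linear0.
Qed.

Lemma bracketC X Y p : bracket X Y p = - bracket Y X p.
Proof. by rewrite /bracket opprB. Qed.

End Charts.

(** * Connections and curvature *)

Section Tensoriality.
Variables (R : realType) (m : nat) (M : smoothManifold R m).
Implicit Types (p q : M) (W : set M) (X Y Z : vfield M).

Lemma smooth_off W : open W -> smooth_fun W (fun q => (q \notin W)%:R : R).
Proof.
move=> oW; apply: smooth_fun_eq (smooth_fun_cst W (0 : R)) => //.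
by move=> q ->.
Qed.

(* The coefficient [q \notin W] vanishes on [W], hence is smooth there:
   function-linearity thus implies locality, without bump functions. *)
Lemma off_split W X X' : {in W, X =1 X'} ->
  X' = fun q => (q \notin W)%:R *: (X' q - X q) + X q.
Proof.
move=> XX'; apply/funext => q; case: (boolP (q \in W)) => [/XX' ->|_].
  by rewrite scale0r add0r.
by rewrite scale1r subrK.
Qed.

(** The common core of tensoriality proofs: an operator linear over functions at [p] sees only the
    value [X p]. Linearity is asked on all smaller open sets because the coordinate expansion of [X]
    exists only on [W' = W & dom p]. *)
Lemma function_linear_expansion (V : lmodType R) (T : vfield M -> V) p W :
  open W -> W p ->
  (forall W' f X Y, open W' -> W' `<=` W -> W' p -> smooth_vfield W' X ->
     smooth_vfield W' Y -> smooth_fun W' f ->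
     T (fun q => f q *: X q + Y q) = f p *: T X + T Y) ->
  forall X, smooth_vfield W X ->
  T X = \sum_i X p 0 i *: T (const_extension p (delta_mx 0 i)).
Proof.
move=> oW Wp Tlin X sX.
pose W' := W `&` dom p; pose E i := const_extension p (delta_mx 0 i : 'rV[R]_m).
have oW' : open W' by apply: openI => //; exact: dom_open.
have W'p : W' p by split=> //; exact: dom_self.
have sW : W' `<=` W by exact: subIsetl.
have sE i : smooth_vfield W' (E i).
  by apply: smooth_vfield_sub (smooth_const_extension p _); exact: subIsetr.
have sX' : smooth_vfield W' X by exact: smooth_vfield_sub sX.
have sc i : smooth_fun W' (component p X i).
  by apply: smooth_component => //; exact: subIsetr.
have T0 : T (fun=> 0) = 0.
  have s0 := smooth_vfield0 W'.
  have := Tlin _ _ _ _ oW' sW W'p s0 s0 (smooth_fun_cst W' 1).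
  under [X in T X]eq_fun do rewrite scaler0 addr0.
  by rewrite scale1r => /eqP; rewrite -subr_eq subrr => /eqP <-.
pose S l q := \sum_(i <- l) component p X i q *: E i q.
have sS l : smooth_vfield W' (S l).
  by apply: smooth_vfield_sum => // i; exact: smooth_vfieldZ.
have TS l : T (S l) = \sum_(i <- l) component p X i p *: T (E i).
  elim: l => [|i l IH].
    by rewrite big_nil -[RHS]T0 /S; under [X in T X]eq_fun do rewrite big_nil.
  rewrite big_cons -IH -(Tlin W') // /S.
  by under [X in T X]eq_fun do rewrite big_cons.
have XS : {in W', S (index_enum 'I_m) =1 X}.
  by move=> q; rewrite inE => -[_ pq]; rewrite [RHS](component_sum X pq).
(* Outside [W'] the field [X] and its expansion may differ; the correction has a coefficient that
   vanishes at [p]. *)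
rewrite [in LHS](off_split XS) (Tlin W') //; last 2 first.
- exact: smooth_vfieldB.
- exact: smooth_off.
have -> : (p \notin W') = false by apply/negbTE; rewrite negbK inE.
rewrite scale0r add0r TS; apply: eq_bigr => i _.
by rewrite /component coord_change_id //; exact: dom_self.
Qed.

End Tensoriality.

(* Conversion between distinct brackets unfolds limits and filters and does not
   terminate in practice, so the atoms are abstracted before rewriting. *)
Ltac abstract_fields :=
  repeat match goal with
  | |- context [?F ?X ?Y ?q] =>
    match type of (F X Y) with vfield _ => generalize (F X Y q); intro end
  | |- context [vderive ?X ?f ?q] => generalize (vderive X f q); intro
  end.

Ltac row_ring := apply/rowP => ?; rewrite !mxE; ring.

Section Connection.
Variables (R : realType) (m : nat) (M : smoothManifold R m).
Variables (g : two_tensor M) (nabla : vfield M -> vfield M -> vfield M).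
Hypotheses (gm : is_pseudo_metric g) (lc : is_levi_civita g nabla).
Implicit Types (p q : M) (W : set M) (X Y Z V : vfield M) (f : M -> R).

Lemma metricDl p x y z : g p (x + y) z = g p x z + g p y z.
Proof. by have := metric_linear gm p z x y 1; rewrite scale1r mul1r. Qed.

Lemma metric0l p z : g p 0 z = 0.
Proof. by apply: (addIr (g p 0 z)); rewrite -metricDl !add0r. Qed.

Lemma metricZl p a x z : g p (a *: x) z = a * g p x z.
Proof. by have := metric_linear gm p z x 0 a; rewrite metric0l !addr0. Qed.

Lemma metricNl p x z : g p (- x) z = - g p x z.
Proof. by rewrite -scaleN1r metricZl mulN1r. Qed.

Lemma metricBl p x y z : g p (x - y) z = g p x z - g p y z.
Proof. by rewrite metricDl metricNl. Qed.

Lemma metricDr p x y z : g p x (y + z) = g p x y + g p x z.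
Proof. by rewrite !(Defs.metric_sym gm p x) metricDl. Qed.

Lemma metricZr p a x y : g p x (a *: y) = a * g p x y.
Proof. by rewrite !(Defs.metric_sym gm p x) metricZl. Qed.

Lemma metricNr p x y : g p x (- y) = - g p x y.
Proof. by rewrite !(Defs.metric_sym gm p x) metricNl. Qed.

Lemma metricBr p x y z : g p x (y - z) = g p x y - g p x z.
Proof. by rewrite !(Defs.metric_sym gm p x) metricBl. Qed.

Lemma metric_suml p (I : Type) (l : seq I) (F : I -> 'rV[R]_m) z :
  g p (\sum_(i <- l) F i) z = \sum_(i <- l) g p (F i) z.
Proof.
elim: l => [|i l IH]; first by rewrite !big_nil metric0l.
by rewrite !big_cons metricDl IH.
Qed.

Lemma nabla_eql W X X' Y p : open W -> W p -> smooth_vfield W X ->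
  smooth_vfield W Y -> {in W, X =1 X'} -> nabla X' Y p = nabla X Y p.
Proof.
move=> oW Wp sX sY XX'; rewrite (off_split XX') (lc_linear_l lc oW) //.
- have -> : (p \notin W) = false by apply/negbTE; rewrite negbK inE.
  by rewrite scale0r add0r.
- by apply: smooth_vfieldB => //; exact: smooth_vfield_eq sX.
- exact: smooth_off.
Qed.

Lemma nabla_eqr W X Y Y' p : open W -> W p -> smooth_vfield W X ->
  smooth_vfield W Y -> {in W, Y =1 Y'} -> nabla X Y' p = nabla X Y p.
Proof.
move=> oW Wp sX sY YY'.
have sY' : smooth_vfield W Y' by exact: smooth_vfield_eq sY.
have sD := smooth_vfieldB oW sY' sY.
rewrite (off_split YY') (lc_add_r lc oW) //; last first.
  by apply: smooth_vfieldZ => //; exact: smooth_off.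
rewrite (lc_leibniz lc oW) //; last exact: smooth_off.
have -> : (p \notin W) = false by apply/negbTE; rewrite negbK inE.
(* The coefficient vanishes on all of [W], so the derivative of it in the Leibniz rule vanishes
   too. *)
rewrite (@vderive_eq _ _ _ W X _ (fun=> 0)) //; last by move=> q /= ->.
by rewrite vderive_cst !scale0r !add0r.
Qed.

Lemma nabla0l W Y p : open W -> W p -> smooth_vfield W Y -> nabla (fun=> 0) Y p = 0.
Proof.
move=> oW Wp sY.
have s0 := smooth_vfield0 W.
have := lc_linear_l lc oW s0 s0 sY (smooth_fun_cst W 1) Wp.
under [X in nabla X]eq_fun do rewrite scaler0 addr0.
by rewrite scale1r => /eqP; rewrite -subr_eq subrr => /eqP <-.
Qed.

Lemma nabla_Zr W X Y (a : R) p : open W -> W p -> smooth_vfield W X ->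
  smooth_vfield W Y -> nabla X (fun q => a *: Y q) p = a *: nabla X Y p.
Proof.
move=> oW Wp sX sY; rewrite (lc_leibniz lc oW) //; last exact: smooth_fun_cst.
by rewrite vderive_cst scale0r add0r.
Qed.

Lemma nabla0r W X p : open W -> W p -> smooth_vfield W X -> nabla X (fun=> 0) p = 0.
Proof.
move=> oW Wp sX; have := nabla_Zr 0 oW Wp sX (smooth_vfield0 W).
by rewrite !scale0r.
Qed.

Lemma nabla_Zl W X Y (a : R) p : open W -> W p -> smooth_vfield W X ->
  smooth_vfield W Y -> nabla (fun q => a *: X q) Y p = a *: nabla X Y p.
Proof.
move=> oW Wp sX sY.
have := lc_linear_l lc oW sX (smooth_vfield0 W) sY (smooth_fun_cst W a) Wp.
under [X in nabla X]eq_fun do rewrite addr0.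
by rewrite (nabla0l oW Wp sY) addr0.
Qed.

(** Torsion-freeness writes the bracket as a difference of covariant derivatives, which are smooth
    by the axioms of the connection; this replaces a computation in charts. *)
Lemma smooth_bracket W X Y : open W -> smooth_vfield W X -> smooth_vfield W Y ->
  smooth_vfield W (bracket X Y).
Proof.
move=> oW sX sY.
have sXY := lc_smooth lc oW sX sY; have sYX := lc_smooth lc oW sY sX.
apply: smooth_vfield_eq (smooth_vfieldB oW sXY sYX) => // q; rewrite inE => Wq.
exact: (lc_torsion_free lc oW sX sY Wq).
Qed.

Lemma bracketE W X Y p : open W -> W p -> smooth_vfield W X -> smooth_vfield W Y ->
  bracket X Y p = nabla X Y p - nabla Y X p.
Proof. by move=> oW Wp sX sY; rewrite (lc_torsion_free lc oW sX sY). Qed.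

Lemma vderive_derive_bracket W X Y Z f p : open W -> W p -> smooth_vfield W X ->
  smooth_vfield W Y -> smooth_vfield W Z -> smooth_fun W f ->
  vderive X (vderive (bracket Y Z) f) p =
  vderive X (vderive Y (vderive Z f)) p - vderive X (vderive Z (vderive Y f)) p.
Proof.
move=> oW Wp sX sY sZ sf.
have sYZ : smooth_fun W (vderive Y (vderive Z f)) by do 2?apply: smooth_vderive.
have sZY : smooth_fun W (vderive Z (vderive Y f)) by do 2?apply: smooth_vderive.
rewrite -(vderiveB X sYZ sZY Wp); apply: (vderive_eq X oW Wp) => q; rewrite inE => Wq.
exact: (vderive_bracket oW sY sZ sf Wq).
Qed.

(** As derivations of functions, both sides expand into third-order terms that cancel formally;
    [vfield_ext] returns to the fields. *)
Lemma jacobi W X Y Z p : open W -> W p -> smooth_vfield W X ->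
  smooth_vfield W Y -> smooth_vfield W Z ->
  bracket X (bracket Y Z) p - bracket Y (bracket X Z) p = bracket (bracket X Y) Z p.
Proof.
move=> oW Wp sX sY sZ.
apply: (@vfield_ext _ _ _ W
  (fun q => bracket X (bracket Y Z) q - bracket Y (bracket X Z) q)
  (bracket (bracket X Y) Z) p oW Wp) => f sf.
have oD : open (W `&` dom p) by apply: openI => //; exact: dom_open.
have Dp : (W `&` dom p) p by split=> //; exact: dom_self.
have DW : W `&` dom p `<=` W by exact: subIsetl.
move: oD Dp (smooth_vfield_sub DW sX) (smooth_vfield_sub DW sY)
  (smooth_vfield_sub DW sZ) sf.
move: (W `&` dom p) => {DW sX sY sZ Wp oW}W oW Wp sX sY sZ sf.
have sYZ := smooth_bracket oW sY sZ; have sXZ := smooth_bracket oW sX sZ.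
have sXY := smooth_bracket oW sX sY.
have sXf := smooth_vderive oW sX sf; have sYf := smooth_vderive oW sY sf.
have sZf := smooth_vderive oW sZ sf.
apply: etrans (vderiveBl _ _ sf Wp) _.
(* Here [xyz] stands for [X (Y (Z f))] at [p], and likewise for the other orders. Stating the
   cancellation over real variables keeps fields out of [ring]. *)
have alg (A B C A1 A2 B1 B2 C1 C2 xyz xzy yxz yzx zxy zyx : R) :
    A = A1 - A2 -> B = B1 - B2 -> C = C1 - C2 ->
    A1 = xyz - xzy -> A2 = yzx - zyx -> B1 = yxz - yzx -> B2 = xzy - zxy ->
    C1 = xyz - yxz -> C2 = zxy - zyx -> A - B = C.
  by move=> -> -> -> -> -> -> -> -> ->; ring.
exact: (alg _ _ _ _ _ _ _ _ _ _ _ _ _ _ _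
  (vderive_bracket oW sX sYZ sf Wp) (vderive_bracket oW sY sXZ sf Wp)
  (vderive_bracket oW sXY sZ sf Wp) (vderive_derive_bracket oW Wp sX sY sZ sf)
  (vderive_bracket oW sY sZ sXf Wp) (vderive_derive_bracket oW Wp sY sX sZ sf)
  (vderive_bracket oW sX sZ sYf Wp) (vderive_bracket oW sX sY sZf Wp)
  (vderive_derive_bracket oW Wp sZ sX sY sf)).
Qed.

Lemma curvatureC W X Y Z p : open W -> W p -> smooth_vfield W X ->
  smooth_vfield W Y -> smooth_vfield W Z ->
  curvature nabla X Y Z p = - curvature nabla Y X Z p.
Proof.
move=> oW Wp sX sY sZ; rewrite /curvature.
have : nabla (bracket X Y) Z p = - nabla (bracket Y X) Z p.
  rewrite -scaleN1r -(nabla_Zl (-1) oW Wp (smooth_bracket oW sY sX) sZ).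
  by congr (nabla _ Z p); apply/funext => q; rewrite scaleN1r -bracketC.
by abstract_fields => ->; row_ring.
Qed.

(** Metric compatibility is used twice on the function g(Z, V). In the commutator of the derivatives
    along [X] and [Y] the mixed terms cancel, and the derivative along [bracket X Y] supplies the
    last term of the curvature. *)
Lemma curvature_skew W X Y Z V p : open W -> W p -> smooth_vfield W X ->
  smooth_vfield W Y -> smooth_vfield W Z -> smooth_vfield W V ->
  g p (curvature nabla X Y Z p) (V p) = - g p (Z p) (curvature nabla X Y V p).
Proof.
move=> oW Wp sX sY sZ sV.
have sZV := metric_smooth gm oW sZ sV.
have second A B : smooth_vfield W A -> smooth_vfield W B ->
    vderive A (vderive B (two_app g Z V)) p =
    g p (nabla A (nabla B Z) p) (V p) + g p (nabla B Z p) (nabla A V p) +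
    (g p (nabla A Z p) (nabla B V p) + g p (Z p) (nabla A (nabla B V) p)).
  move=> sA sB; have sBZ := lc_smooth lc oW sB sZ; have sBV := lc_smooth lc oW sB sV.
  have -> : vderive A (vderive B (two_app g Z V)) p = vderive A
      (fun q => two_app g (nabla B Z) V q + two_app g Z (nabla B V) q) p.
    apply: (vderive_eq A oW Wp) => q; rewrite inE => Wq.
    exact: (lc_metric lc oW sB sZ sV Wq).
  rewrite (vderiveD A (metric_smooth gm oW sBZ sV) (metric_smooth gm oW sZ sBV) Wp).
  by rewrite (lc_metric lc oW sA sBZ sV Wp) (lc_metric lc oW sA sZ sBV Wp).
have := vderive_bracket oW sX sY sZV Wp.
rewrite (lc_metric lc oW (smooth_bracket oW sX sY) sZ sV Wp) !second //.
rewrite /curvature !metricBl !metricBr => E.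
by apply/eqP; rewrite -subr_eq0 opprK; apply/eqP; move: E; lra.
Qed.

(** The Leibniz term Y(f) nabla_{X1} Z produced by the second covariant derivative is cancelled by
    the one from [f X1, Y] = f [X1, Y] - Y(f) X1. *)
Lemma curvature_linear_l W f X1 X2 Y Z p : open W -> W p -> smooth_vfield W X1 ->
  smooth_vfield W X2 -> smooth_vfield W Y -> smooth_vfield W Z -> smooth_fun W f ->
  curvature nabla (fun q => f q *: X1 q + X2 q) Y Z p =
  f p *: curvature nabla X1 Y Z p + curvature nabla X2 Y Z p.
Proof.
move=> oW Wp s1 s2 sY sZ sf.
have sYZ := lc_smooth lc oW sY sZ.
have s1Z := lc_smooth lc oW s1 sZ; have s2Z := lc_smooth lc oW s2 sZ.
have sb1 := smooth_bracket oW s1 sY; have sb2 := smooth_bracket oW s2 sY.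
have sYf := smooth_vderive oW sY sf.
have sX := smooth_vfieldD oW (smooth_vfieldZ oW sf s1) s2.
rewrite /curvature; have E1 := lc_linear_l lc oW s1 s2 sYZ sf Wp.
have E2 : nabla Y (nabla (fun q => f q *: X1 q + X2 q) Z) p =
    vderive Y f p *: nabla X1 Z p + f p *: nabla Y (nabla X1 Z) p
    + nabla Y (nabla X2 Z) p.
  rewrite -(lc_leibniz lc oW sY s1Z sf Wp).
  rewrite -(lc_add_r lc oW sY (smooth_vfieldZ oW sf s1Z) s2Z Wp).
  apply: (nabla_eqr oW Wp sY).
    exact: smooth_vfieldD (smooth_vfieldZ oW sf s1Z) s2Z.
  move=> q; rewrite inE => Wq; exact: esym (lc_linear_l lc oW s1 s2 sZ sf Wq).
have E3 : nabla (bracket (fun q => f q *: X1 q + X2 q) Y) Z p =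
    f p *: nabla (bracket X1 Y) Z p
    + (nabla (bracket X2 Y) Z p - vderive Y f p *: nabla X1 Z p).
  have sYf1 : smooth_fun W (fun q => - vderive Y f q).
    apply: smooth_fun_eq (smooth_funB oW (smooth_fun_cst W 0) sYf) => // q _.
    by rewrite sub0r.
  have sc := smooth_vfieldD oW (smooth_vfieldZ oW sYf1 s1) sb2.
  have -> : nabla (bracket X2 Y) Z p - vderive Y f p *: nabla X1 Z p =
      - vderive Y f p *: nabla X1 Z p + nabla (bracket X2 Y) Z p.
    by rewrite scaleNr addrC.
  rewrite -(lc_linear_l lc oW s1 sb2 sZ sYf1 Wp) -(lc_linear_l lc oW sb1 sc sZ sf Wp).
  apply: (nabla_eql oW Wp) => //.
    exact: smooth_vfieldD (smooth_vfieldZ oW sf sb1) sc.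
  move=> q; rewrite inE => Wq; rewrite !(bracketE oW Wq) //.
  have F1 := lc_linear_l lc oW s1 s2 sY sf Wq.
  have F2 : nabla Y (fun q => f q *: X1 q + X2 q) q =
      nabla Y (fun q => f q *: X1 q) q + nabla Y X2 q.
    exact: (lc_add_r lc oW sY (smooth_vfieldZ oW sf s1) s2 Wq).
  have F3 := lc_leibniz lc oW sY s1 sf Wq.
  by move: F1 F2 F3; abstract_fields => -> -> ->; row_ring.
by move: E1 E2 E3; abstract_fields => -> -> ->; row_ring.
Qed.

Lemma curvature_expansion_l W X Y Z p : open W -> W p -> smooth_vfield W X ->
  smooth_vfield W Y -> smooth_vfield W Z ->
  curvature nabla X Y Z p =
  \sum_i X p 0 i *: curvature nabla (const_extension p (delta_mx 0 i)) Y Z p.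
Proof.
move=> oW Wp sX sY sZ.
apply: (function_linear_expansion (T := fun X => curvature nabla X Y Z p) oW Wp) => //.
move=> W' f A B oW' sW W'p sA sB sf; apply: (curvature_linear_l oW') => //;
  by exact: smooth_vfield_sub sW _.
Qed.

(** Linearity over functions is established in the first slot only. The second slot follows by
    antisymmetry; for the third, skewness moves [Z] out of the curvature, where only [Z p] counts,
    and nondegeneracy of [g] concludes. *)
Lemma curvature_tensorial W X Y Z p : open W -> W p -> smooth_vfield W X ->
  smooth_vfield W Y -> smooth_vfield W Z ->
  curvature nabla X Y Z p = curvature_at nabla p (X p) (Y p) (Z p).
Proof.
move=> oW Wp sX sY sZ; have DW : W `&` dom p `<=` W by exact: subIsetl.
have oD : open (W `&` dom p) by apply: openI => //; exact: dom_open.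
have Dp : (W `&` dom p) p by split=> //; exact: dom_self.
have sE x : smooth_vfield (W `&` dom p) (const_extension p x).
  by apply: smooth_vfield_sub (smooth_const_extension p x); exact: subIsetr.
move: oD Dp (smooth_vfield_sub DW sX) (smooth_vfield_sub DW sY)
  (smooth_vfield_sub DW sZ) sE.
move: (W `&` dom p) => {DW sX sY sZ Wp oW}W oW Wp sX sY sZ sE.
have left A B C : smooth_vfield W A -> smooth_vfield W B -> smooth_vfield W C ->
    curvature nabla A B C p = curvature nabla (const_extension p (A p)) B C p.
  move=> sA sB sC; rewrite (curvature_expansion_l oW Wp sA sB sC).
  rewrite (curvature_expansion_l oW Wp (sE (A p)) sB sC).
  by rewrite const_extension_center.
rewrite (left X Y Z) // (curvatureC oW Wp) // (left Y) // -(curvatureC oW Wp) //.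
apply/eqP; rewrite -subr_eq0; apply/eqP; apply: (metric_nondegenerate gm (p := p)) => y.
have skew C : smooth_vfield W C ->
    g p (curvature nabla (const_extension p (X p)) (const_extension p (Y p)) C p) y =
    - g p (C p) (curvature nabla (const_extension p (X p)) (const_extension p (Y p))
      (const_extension p y) p).
  move=> sC; have := curvature_skew oW Wp (sE (X p)) (sE (Y p)) sC (sE y).
  by rewrite const_extension_center.
by rewrite metricBl (skew Z sZ) (skew _ (sE (Z p))) const_extension_center subrr.
Qed.

Local Notation Rm := (curvature_at nabla).

Lemma curvature_at_linear p y z : linear (fun x => Rm p x y z).
Proof.
have oD := dom_open p; have Dp := dom_self p; have sE := smooth_const_extension p.
have expand x : Rm p x y z = \sum_i x 0 i *: Rm p (delta_mx 0 i) y z.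
  by rewrite {1}/curvature_at (curvature_expansion_l oD Dp) // const_extension_center.
move=> a x1 x2; rewrite expand (expand x1) (expand x2) scaler_sumr -big_split.
by apply: eq_bigr => i _; rewrite !mxE scalerDl scalerA.
Qed.

Lemma curvature_atC p x y z : Rm p x y z = - Rm p y x z.
Proof.
have sE := smooth_const_extension p.
exact: (curvatureC (dom_open p) (dom_self p) (sE x) (sE y) (sE z)).
Qed.

Lemma curvature_at_skew p x y z w : g p (Rm p x y z) w = - g p z (Rm p x y w).
Proof.
have sE := smooth_const_extension p.
have := curvature_skew (dom_open p) (dom_self p) (sE x) (sE y) (sE z) (sE w).
by rewrite !const_extension_center.
Qed.

Lemma curvature_atDm p x y1 y2 z : Rm p x (y1 + y2) z = Rm p x y1 z + Rm p x y2 z.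
Proof.
rewrite !(curvature_atC _ x) -opprD; congr (- _).
by have := curvature_at_linear p x z 1 y1 y2; rewrite /= !scale1r.
Qed.

Lemma curvature_atDr p x y z1 z2 : Rm p x y (z1 + z2) = Rm p x y z1 + Rm p x y z2.
Proof.
apply/eqP; rewrite -subr_eq0; apply/eqP; apply: (metric_nondegenerate gm (p := p)) => w.
by rewrite metricBl metricDl !curvature_at_skew metricDl opprD subrr.
Qed.

Lemma curvature_at_diag p x z : Rm p x x z = 0.
Proof.
apply/rowP => i; have := curvature_atC p x x z => /rowP/(_ i); rewrite !mxE; lra.
Qed.

Lemma metric_curvature_at p x y z : g p (Rm p x y z) z = 0.
Proof. by have := curvature_at_skew p x y z z; rewrite (Defs.metric_sym gm p z); lra. Qed.

End Connection.

(** * Indefinite S-manifolds *)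

Section IndefiniteSManifolds.
Variables (R : realType) (n s : nat) (M : smoothManifold R (2 * n + s)).
Variables (S : gff_structure M) (eps : 'I_s -> R) (g : two_tensor M).
Variable nabla : vfield M -> vfield M -> vfield M.
Hypotheses (HS : is_indefinite_S S eps g) (lc : is_levi_civita g nabla).
Implicit Types (p q : M) (W : set M) (X Y Z V : vfield M) (a b c : 'I_s).

Local Notation phi := (gff_phi S).
Local Notation xi := (gff_xi S).
Local Notation eta := (gff_eta S).

Let gm : is_pseudo_metric g := img_metric (indefS_metric HS).

Lemma eta_sum_xi p (k : 'I_s -> R) b :
  eta b p (\sum_(a < s) k a *: xi a p) = k b.
Proof.
rewrite linear_sum (bigD1 b) //= linearZ /= gff_eta_xi eqxx big1 => [|a ab].
  by rewrite addr0 [_ *: _]mulr1.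
by rewrite linearZ /= gff_eta_xi eq_sym (negbTE ab) [_ *: _]mulr0.
Qed.

(** A dimension count: the formula for phi^2 puts the kernel of [phi p] inside the span of the
    characteristic vectors, and the rank condition gives this kernel dimension [s], so the two
    spaces coincide. *)
Lemma phi_xi p b : phi p (xi b p) = 0.
Proof.
pose X := [tuple xi a p | a < s].
have dimK : \dim (lker (phi p)) = s.
  have := limg_ker_dim (phi p) fullv.
  by rewrite capfv gff_phi_rank dimvf /dim /= mul1n addnC => /addnI.
have sK : (lker (phi p) <= <<X>>)%VS.
  apply/subvP => x; rewrite memv_ker => /eqP x0.
  have := gff_phi2 S p x; rewrite x0 linear0 => /esym/eqP.
  rewrite addrC subr_eq0 => /eqP <-; apply: memv_suml => a _; apply: memvZ.
  by apply: memv_span; apply/tnthP; exists a; rewrite tnth_mktuple.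
have /eqP EK : (lker (phi p) == <<X>>)%VS.
  by rewrite eqEdim sK dimK; apply: leq_trans (dim_span _) _; rewrite size_tuple.
apply/eqP; rewrite -memv_ker EK; apply: memv_span.
by apply/tnthP; exists b; rewrite tnth_mktuple.
Qed.

(** phi^3 is computed in two ways, as phi applied to phi^2 x and as phi^2 applied to phi x;
    comparing the coefficients of [xi b] gives the claim. *)
Lemma eta_phi p b x : eta b p (phi p x) = 0.
Proof.
have E : phi p (phi p (phi p x)) = - phi p x.
  rewrite (gff_phi2 S p x) linearD linearN linear_sum /= big1 ?addr0 // => a _.
  by rewrite linearZ /= phi_xi scaler0.
move: (gff_phi2 S p (phi p x)); rewrite E -[LHS]addr0 => /addrI/esym/(congr1 (eta b p)).
by rewrite eta_sum_xi linear0.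
Qed.

Lemma metric_xi p b x : g p x (xi b p) = eps b * eta b p x.
Proof.
have := img_compatible (indefS_metric HS) p x (xi b p).
rewrite phi_xi (Defs.metric_sym gm) (metric0l gm) => /esym/eqP.
rewrite subr_eq0 => /eqP ->; rewrite (bigD1 b) //= gff_eta_xi eqxx mulr1.
by rewrite big1 ?addr0 // => a ab; rewrite gff_eta_xi (negbTE ab) mulr0.
Qed.

Lemma phi_skew p x y : g p (phi p x) y = - g p x (phi p y).
Proof.
have := img_compatible (indefS_metric HS) p x (phi p y).
rewrite [X in _ - X]big1; last by move=> a _; rewrite eta_phi mulr0.
rewrite subr0 gff_phi2 (metricDr gm) (metricNr gm) => <-.
rewrite (Defs.metric_sym gm _ _ (\sum_(_ < _) _)) (metric_suml gm) big1.
  by rewrite addr0 opprK.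
by move=> a _; rewrite (metricZl gm) (Defs.metric_sym gm) metric_xi eta_phi !mulr0.
Qed.

Lemma smooth_xi W a : smooth_vfield W (xi a).
Proof. by apply: smooth_vfield_sub (gff_xi_smooth S a). Qed.

Lemma form_app_phi b X : form_app (eta b) (endo_app phi X) = fun=> 0.
Proof. by apply/funext => q; rewrite /form_app /endo_app eta_phi. Qed.

Lemma form_app_xi a b : form_app (eta b) (xi a) = fun=> (b == a)%:R.
Proof. by apply/funext => q; rewrite /form_app gff_eta_xi. Qed.

Lemma endo_app_xi a : endo_app phi (xi a) = fun=> 0.
Proof. by apply/funext => q; rewrite /endo_app phi_xi. Qed.

Lemma eta_bracket W X Y b p : open W -> W p -> smooth_vfield W X ->
  smooth_vfield W Y -> eta b p (bracket X Y p) =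
  vderive X (form_app (eta b) Y) p - vderive Y (form_app (eta b) X) p
  - 2 * g p (X p) (phi p (Y p)).
Proof.
move=> oW Wp sX sY; rewrite -(indefS_dform HS oW sX sY b Wp) /dform mulrA mulfV //.
by rewrite mul1r opprB addrCA subrr addr0.
Qed.

Lemma metric_xi_phi p a x : g p (xi a p) (phi p x) = 0.
Proof. by rewrite (Defs.metric_sym gm) metric_xi eta_phi mulr0. Qed.

Lemma eta_bracket_xi W X a b p : open W -> W p -> smooth_vfield W X ->
  eta b p (bracket (xi a) X p) = vderive (xi a) (form_app (eta b) X) p.
Proof.
move=> oW Wp sX; rewrite (eta_bracket _ oW Wp (smooth_xi W a) sX).
by rewrite form_app_xi vderive_cst metric_xi_phi mulr0 !subr0.
Qed.

Lemma gff_decomposition p x : phi p x = 0 -> (forall b, eta b p x = 0) -> x = 0.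
Proof.
move=> px ex; have := gff_phi2 S p x; rewrite px linear0 big1 ?addr0.
  by move/eqP; rewrite eq_sym oppr_eq0 => /eqP.
by move=> a _; rewrite ex scale0r.
Qed.

(* Normality gives [L_xi phi = 0]. *)
Lemma phi_bracket_xi W X a p : open W -> W p -> smooth_vfield W X ->
  phi p (bracket (xi a) X p) = bracket (xi a) (endo_app phi X) p.
Proof.
move=> oW Wp sX; have spX := gff_phi_smooth S oW sX.
have := indefS_normal HS oW (smooth_xi W a) sX Wp.
rewrite big1; last first.
  move=> b _; rewrite (indefS_dform HS oW (smooth_xi W a) sX b Wp).
  by rewrite metric_xi_phi scale0r.
rewrite scaler0 addr0 /nijenhuis endo_app_xi !bracket0l linear0 addr0 subr0 => E.
(* Normality has been reduced to phi (phi [xi, X] - [xi, phi X]) = 0, so it remains to see that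
   every [eta b] kills the difference. *)
apply/eqP; rewrite -subr_eq0; apply/eqP; apply: (@gff_decomposition p).
  by rewrite linearB.
move=> b; rewrite linearB /= eta_phi (eta_bracket_xi _ _ oW Wp spX).
by rewrite form_app_phi vderive_cst subr0.
Qed.

Lemma bracket_xi_xi a b p : bracket (xi a) (xi b) p = 0.
Proof.
have sx := smooth_xi setT b.
apply: (@gff_decomposition p) => [|c].
  by rewrite (phi_bracket_xi _ openT I sx) endo_app_xi bracketC bracket0l oppr0.
by rewrite (eta_bracket_xi _ _ openT I sx) form_app_xi vderive_cst.
Qed.

(* [L_xi Phi = 0], since [Phi = d eta] and [i_xi (d eta) = 0]. *)
Lemma lie_xi_Phi W X Y a p : open W -> W p -> smooth_vfield W X ->
  smooth_vfield W Y -> vderive (xi a) (two_app g X (endo_app phi Y)) p =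
  g p (bracket (xi a) X p) (phi p (Y p)) + g p (X p) (phi p (bracket (xi a) Y p)).
Proof.
have alg2 (x y z w : R) : x = y - z -> w = z -> y = x + w.
  by move=> -> ->; rewrite subrK.
have alg (t A B C C' A1 A2 B1 B2 jx jy u v : R) : t + t = A - B - C ->
    A = A1 + A2 -> B = B1 + B2 -> C' = C -> C' - jx = jy ->
    jy = A1 - B2 - 2 * u -> jx = A2 - B1 - 2 * v -> t = u + v by lra.
move=> oW Wp sX sY; have sx := smooth_xi W a.
have spY := gff_phi_smooth S oW sY.
have sF := metric_smooth gm oW sX spY.
have sb := smooth_bracket lc oW.
have sxX := sb _ _ sx sX; have sxY := sb _ _ sx sY; have sXY := sb _ _ sX sY.
have seta Z : smooth_vfield W Z -> smooth_fun W (form_app (eta a) Z).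
  exact: (gff_eta_smooth S a).
have sXeY := smooth_vderive oW sX (seta _ sY).
have sYeX := smooth_vderive oW sY (seta _ sX).
set h := two_app g X (endo_app phi Y).
(* The derivative is doubled because of the factor 1/2 in [dform]: 2 g(X, phi Y) = X(eta Y) - Y(eta
   X) - eta [X, Y] holds on [W] and is differentiated along [xi a]. *)
have E0 : vderive (xi a) h p + vderive (xi a) h p =
    vderive (xi a) (vderive X (form_app (eta a) Y)) p
    - vderive (xi a) (vderive Y (form_app (eta a) X)) p
    - vderive (xi a) (form_app (eta a) (bracket X Y)) p.
  rewrite -(vderiveD _ sF sF Wp) -(vderiveB _ sXeY sYeX Wp).
  rewrite -(vderiveB _ (smooth_funB oW sXeY sYeX) (seta _ sXY) Wp).
  apply: (vderive_eq _ oW Wp) => q; rewrite inE => Wq.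
  have := eta_bracket a oW Wq sX sY; rewrite /form_app /h /two_app /endo_app => ->.
  ring.
(* This is the product rule for the Lie derivative along [xi a], with L_xi eta = 0 in the form eta
   [xi, U] = xi(eta U). *)
have commute Z U : smooth_vfield W Z -> smooth_vfield W U ->
    vderive (xi a) (vderive Z (form_app (eta a) U)) p =
    vderive (bracket (xi a) Z) (form_app (eta a) U) p +
    vderive Z (form_app (eta a) (bracket (xi a) U)) p.
  move=> sZ sU; have F1 := vderive_bracket oW sx sZ (seta _ sU) Wp.
  have F2 : vderive Z (form_app (eta a) (bracket (xi a) U)) p =
      vderive Z (vderive (xi a) (form_app (eta a) U)) p.
    apply: (vderive_eq _ oW Wp) => q; rewrite inE => Wq.
    exact: (eta_bracket_xi a a oW Wq sU).
  exact: (alg2 _ _ _ _ F1 F2).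
have E1 := commute _ _ sX sY; have E2 := commute _ _ sY sX.
have E3 := eta_bracket_xi a a oW Wp sXY.
have E4 := congr1 (eta a p) (jacobi lc oW Wp sx sX sY).
have E5 := eta_bracket a oW Wp sxX sY; have E6 := eta_bracket a oW Wp sX sxY.
rewrite linearB /= in E4.
exact: (alg _ _ _ _ _ _ _ _ _ _ _ _ _ E0 E1 E2 E3 E4 E5 E6).
Qed.

(** The right-hand side is the Lie derivative (L_xi g)(X, Y), so its vanishing is the Killing
    equation. *)
Lemma killing_formula W X Y a p : open W -> W p -> smooth_vfield W X ->
  smooth_vfield W Y ->
  g p (nabla X (xi a) p) (Y p) + g p (nabla Y (xi a) p) (X p) =
  vderive (xi a) (two_app g X Y) p - g p (bracket (xi a) X p) (Y p)
  - g p (X p) (bracket (xi a) Y p).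
Proof.
move=> oW Wp sX sY; have sx := smooth_xi W a.
rewrite (lc_metric lc oW sx sX sY Wp).
rewrite (bracketE lc oW Wp sx sX) (bracketE lc oW Wp sx sY).
rewrite (metricBl gm) (metricBr gm) (Defs.metric_sym gm p (X p) (nabla Y _ p)).
ring.
Qed.

(** For pairs (X, phi Y), L_xi g = 0 is L_xi Phi = 0 after L_xi phi = 0 has moved phi across the
    bracket. *)
Lemma killing_phi W X Y a p : open W -> W p -> smooth_vfield W X ->
  smooth_vfield W Y ->
  g p (nabla X (xi a) p) (phi p (Y p)) + g p (nabla (endo_app phi Y) (xi a) p) (X p) = 0.
Proof.
move=> oW Wp sX sY; have spY := gff_phi_smooth S oW sY.
have := killing_formula a oW Wp sX spY.
rewrite (lie_xi_Phi a oW Wp sX sY) -(phi_bracket_xi a oW Wp sY) => ->.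
ring.
Qed.

(** Along [xi b] the metric is g(X, xi_b) = eps_b eta^b(X), so L_xi g = 0 reduces to eta^b [xi_a, X]
    = xi_a(eta^b X) and [xi_a, xi_b] = 0. *)
Lemma killing_xi W X a b p : open W -> W p -> smooth_vfield W X ->
  g p (nabla X (xi a) p) (xi b p) + g p (nabla (xi b) (xi a) p) (X p) = 0.
Proof.
move=> oW Wp sX; rewrite (killing_formula a oW Wp sX (smooth_xi W b)).
rewrite bracket_xi_xi [X in _ - X](Defs.metric_sym gm) (metric0l gm) subr0.
rewrite metric_xi (eta_bracket_xi a b oW Wp sX).
rewrite -(vderiveZ _ _ (gff_eta_smooth S b oW sX) Wp).
rewrite (_ : two_app g X (xi b) = fun q => eps b * form_app (eta b) X q) ?subrr //.
by apply/funext => q; exact: metric_xi.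
Qed.

(** The formula for phi^2 gives Y = sum_b eta^b(Y) xi_b + phi (phi (-Y)); the expression is linear
    over functions in [Y], so the two previous cases suffice. *)
Lemma killing W X Y a p : open W -> W p -> smooth_vfield W X -> smooth_vfield W Y ->
  g p (nabla X (xi a) p) (Y p) + g p (nabla Y (xi a) p) (X p) = 0.
Proof.
move=> oW Wp sX sY; have sx := smooth_xi W a.
have sN := gff_phi_smooth S oW (smooth_vfieldN oW sY).
have sNN := gff_phi_smooth S oW sN.
pose N := endo_app phi (endo_app phi (fun q => - Y q)).
(* Partial sums of this decomposition: the part in the image of [phi] is the base case, and each
   further index adds one multiple of [xi b]. *)
pose T l q := \sum_(b <- l) form_app (eta b) Y q *: xi b q + N q.
have YT : Y = T (index_enum 'I_s).
  apply/funext => q; rewrite /T /N /endo_app gff_phi2 opprK addrCA -big_split /=.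
  rewrite big1 ?addr0 // => b _.
  by rewrite /form_app linearN scaleNr subrr.
have seta b := gff_eta_smooth S b oW sY.
have sT l : smooth_vfield W (T l).
  apply: smooth_vfieldD => //; apply: smooth_vfield_sum => // b.
  by apply: smooth_vfieldZ => //; exact: smooth_xi.
rewrite YT; elim: (index_enum _) => [|b l IH].
  have -> : T [::] = N by apply/funext => q; rewrite /T big_nil add0r.
  exact: killing_phi oW Wp sX sN.
have -> : T (b :: l) = fun q => form_app (eta b) Y q *: xi b q + T l q.
  by apply/funext => q; rewrite /T big_cons addrA.
rewrite (lc_linear_l lc oW (smooth_xi W b) (sT l) sx (seta b) Wp).
rewrite (metricDl gm) (metricDr gm) (metricZl gm) (metricZr gm) addrACA IH addr0.
by rewrite -mulrDr (killing_xi _ _ oW Wp sX) mulr0.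
Qed.

(** Differentiating g(xi_a, Y) = eps_a eta^a(Y) and antisymmetrising gives g(nabla_X xi_a, Y) -
    g(nabla_Y xi_a, X) = 2 eps_a g(X, phi Y). By [killing] the symmetric part is zero, and
    [phi_skew] moves phi onto [X]. *)
Lemma nabla_xi W X a p : open W -> W p -> smooth_vfield W X ->
  nabla X (xi a) p = - eps a *: phi p (X p).
Proof.
have alg (e u v x1 y1 x2 y2 t : R) : e * u = x1 + e * x2 -> e * v = y1 + e * y2 ->
    x2 - y2 = u - v - 2 * t -> x1 + y1 = 0 -> x1 - (- e * - t) = 0.
  move=> F1 F2 F3 F4; have : e * (u - v - 2 * t) = e * (x2 - y2) by rewrite F3.
  by rewrite !mulrBr F1 F2; lra.
move=> oW Wp sX; apply/eqP; rewrite -subr_eq0; apply/eqP.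
apply: (metric_nondegenerate gm (p := p)) => y.
pose D := W `&` dom p.
have oD : open D by apply: openI => //; exact: dom_open.
have Dp : D p by split=> //; exact: dom_self.
have {}sX : smooth_vfield D X by apply: smooth_vfield_sub sX; exact: subIsetl.
have sY : smooth_vfield D (const_extension p y).
  by apply: smooth_vfield_sub (smooth_const_extension p y); exact: subIsetr.
set Y := const_extension p y in sY; have sx := smooth_xi D a.
have Yp : Y p = y by exact: const_extension_center.
have gxi Z : two_app g (xi a) Z = fun q => eps a * form_app (eta a) Z q.
  by apply/funext => q; rewrite /two_app (Defs.metric_sym gm) metric_xi.
have seta Z : smooth_vfield D Z -> smooth_fun D (form_app (eta a) Z).
  exact: (gff_eta_smooth S a).
have half A B : smooth_vfield D A -> smooth_vfield D B ->
    eps a * vderive A (form_app (eta a) B) p =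
    g p (nabla A (xi a) p) (B p) + eps a * eta a p (nabla A B p).
  move=> sA sB; rewrite -(vderiveZ _ _ (seta _ sB) Dp) -gxi.
  by rewrite (lc_metric lc oD sA sx sB Dp) (Defs.metric_sym gm _ (xi a p)) metric_xi.
have E1 := half _ _ sX sY; have E2 := half _ _ sY sX.
have E3 := eta_bracket a oD Dp sX sY.
rewrite (bracketE lc oD Dp sX sY) linearB /= in E3.
have E4 := killing a oD Dp sX sY.
rewrite (metricBl gm) (metricZl gm) phi_skew -Yp.
exact: (alg _ _ _ _ _ _ _ _ E1 E2 E3 E4).
Qed.

(** Two terms contain the unknown nabla_{xi_b} (phi X): one directly, the other through phi
    [X, xi_b] = - [xi_b, phi X] and torsion-freeness. They cancel and leave nabla_{phi X} xi_b = -
    eps_b phi^2 X. *)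
Lemma curvature_xi W X a b p : open W -> W p -> smooth_vfield W X ->
  curvature nabla X (xi b) (xi a) p = - (eps a * eps b) *: phi p (phi p (X p)).
Proof.
move=> oW Wp sX; have sb := smooth_xi W b; have sa := smooth_xi W a.
have spX := gff_phi_smooth S oW sX.
have sbr := smooth_bracket lc oW sX sb.
have E1 : nabla X (nabla (xi b) (xi a)) p = 0.
  rewrite (nabla_eqr lc (Y := fun=> 0) oW Wp sX (smooth_vfield0 W)).
    exact: (nabla0r lc oW Wp sX).
  by move=> q; rewrite inE => Wq; rewrite (nabla_xi _ oW Wq sb) phi_xi scaler0.
have E2 : nabla (xi b) (nabla X (xi a)) p = - eps a *: nabla (xi b) (endo_app phi X) p.
  rewrite -(nabla_Zr lc _ oW Wp sb spX); apply: (nabla_eqr lc oW Wp sb).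
    by apply: smooth_vfieldZ => //; exact: smooth_fun_cst.
  by move=> q; rewrite inE => Wq; rewrite (nabla_xi _ oW Wq sX).
have E3 := nabla_xi a oW Wp sbr.
rewrite bracketC linearN /= (phi_bracket_xi _ oW Wp sX) in E3.
rewrite (bracketE lc oW Wp sb spX) (nabla_xi b oW Wp spX) in E3.
rewrite /curvature E1 E2 E3 /endo_app.
by move: (nabla _ _ p) => v; row_ring.
Qed.

End IndefiniteSManifolds.

(** * Null Jacobi operators *)

(** The quotient of [U] by the line of [u] is modelled by a complement [C] of that line in [U], with
    the projection along [u]. *)
Lemma endomorphism_mod_line (R : realType) (m : nat) (u : 'rV[R]_m)
    (U : {vspace 'rV[R]_m}) (T : {linear 'rV[R]_m -> 'rV[R]_m}) :
  u != 0 -> u \in U -> (forall x, x \in U -> T x \in U) -> T u = 0 ->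
  exists (Q : vectType R) (pi : {linear subvs_of U -> Q}) (Tq : 'End(Q)),
    [/\ is_quotient_by u pi, forall x : subvs_of U,
        exists2 y : subvs_of U, vsval y = T (vsval x) & Tq (pi x) = pi y &
      (\dim {:Q}).+1 = \dim U].
Proof.
move=> u0 uU TU Tu; pose C := (U :\: <[u]>)%VS; pose pr := addv_pi1 U <[u]>%VS.
have prC x : pr x \in C by exact: memv_pi.
have CU x : x \in C -> x \in U by apply/subvP; exact: diffvSl.
have prD x : x \in U -> exists a, x = pr x + a *: u.
  move=> xU; have /vlineP[a aE] : addv_pi2 U <[u]>%VS x \in <[u]>%VS by exact: memv_pi2.
  by exists a; rewrite -aE addv_pi1_pi2 //; apply: subvP xU; exact: addvSl.
have pr_id x : x \in C -> pr x = x.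
  by move=> xC; apply: daddv_pi_id => //; rewrite capv_diff.
have pr_line x : x \in <[u]>%VS -> pr x = 0.
  move=> xu; have := @addv_pi1_pi2 _ _ U <[u]>%VS x (subvP (addvSr _ _) _ xu).
  by rewrite (addv_pi2_id U xu) -/pr -[RHS]add0r => /addIr.
pose pi : {linear subvs_of U -> subvs_of C} := vsproj C \o pr \o vsval.
pose J : {linear subvs_of C -> subvs_of C} := vsproj C \o pr \o T \o vsval.
exists (subvs_of C), pi, (linfun J); split.
- split=> [y|x].
    exists (vsproj U (vsval y)); rewrite /= vsprojK ?CU ?subvsP //.
    by rewrite pr_id ?subvsP // vsvalK.
  split=> [/= /(congr1 vsval)|xu]; last by rewrite /= pr_line ?linear0.
  rewrite vsprojK // linear0 => pr0; have [a ->] := prD _ (subvsP x).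
  by rewrite pr0 add0r memvZ // memv_line.
- move=> x; have Tx := TU _ (subvsP x).
  exists (vsproj U (T (vsval x))); first by rewrite vsprojK.
  rewrite lfunE /= !vsprojK //; congr (vsproj C (pr _)).
  (* A vector and its projection differ by a multiple of [u], which [T] kills; so [T] descends. *)
  have [a aE] := prD _ (subvsP x).
  by rewrite [in RHS]aE linearD linearZ /= Tu scaler0 addr0.
- have uU' : (<[u]> <= U)%VS by rewrite -memvE.
  have := dimv_cap_compl U <[u]>%VS; rewrite (capv_idPr uU') dim_vline u0 -/C => <-.
  by rewrite dimvf add1n.
Qed.

Section NullVectors.
Variables (R : realType) (m : nat) (M : smoothManifold R m).
Variables (g : two_tensor M) (nabla : vfield M -> vfield M -> vfield M).
Implicit Types (p : M) (x y z u w : 'rV[R]_m).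

(* A combination of [x] and [w] orthogonal to the timelike basis vector is
   spacelike, so [w] cannot be causal. *)
Lemma lorentzian_orthogonal_spacelike p x w (i0 : 'I_m) : i0 = 0%N :> nat ->
  is_lorentzian g -> g p x x = -1 -> g p w x = 0 -> w != 0 -> 0 < g p w w.
Proof.
move=> i00 [gm gL] xx wx w0; have [e eU eE] := gL p.
pose c y i := (y *m invmx e) 0 i.
have cE y : y = \sum_i c y i *: row i e by rewrite -mulmx_sum_row mulmxKV.
have clin a b y y' : c (a *: y - b *: y') i0 = a * c y i0 - b * c y' i0.
  rewrite /c mulmxBl -!scalemxAl; move: (y *m _) (y' *m _) => Y Y'.
  by rewrite !mxE.
have gE y : c y i0 = 0 -> g p y y = \sum_i c y i ^+ 2.
  move=> y0; rewrite {1}(cE y) (metric_suml gm); apply: eq_bigr => i _.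
  have -> : g p (c y i *: row i e) y =
      c y i * \sum_j c y j * g p (row j e) (row i e).
    rewrite (metricZl gm) (Defs.metric_sym gm) {2}(cE y) (metric_suml gm).
    by congr (_ * _); apply: eq_bigr => j _; rewrite (metricZl gm).
  rewrite expr2; congr (_ * _); rewrite (bigD1 i) //= big1 => [|j ji].
    rewrite eE eqxx /= addr0; case: eqP => [i0'|_]; last by rewrite mulr1.
    by rewrite (_ : i = i0) ?y0 ?mul0r //; apply: val_inj; rewrite /= i0' i00.
  by rewrite eE ji mulr0.
have g0 y : c y i0 = 0 -> g p y y <= 0 -> y = 0.
  move=> y0; rewrite (gE y y0) => le0; rewrite (cE y) big1 // => i _.
  have /eqP : \sum_i c y i ^+ 2 = 0.
    by apply/eqP; rewrite eq_le le0 sumr_ge0 // => j _; exact: sqr_ge0.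
  rewrite psumr_eq0 => [|j _]; last exact: sqr_ge0.
  by move=> /allP/(_ i (mem_index_enum i)); rewrite sqrf_eq0 => /eqP ->; rewrite scale0r.
have cx0 : c x i0 != 0.
  apply/eqP => /g0; rewrite xx oppr_le0 ler01 => /(_ isT) x0.
  by move: xx; rewrite x0 (metric0l gm) => /eqP; rewrite eq_sym oppr_eq0 oner_eq0.
rewrite ltNge; apply/negP => ww.
(* The coefficients make the timelike coordinate of [z] vanish. Since g(z, z) = c_x^2 g(w, w) -
   c_w^2, a nonpositive g(w, w) forces z = 0; pairing with [x] then gives c_w = 0, hence w = 0. *)
pose z := c w i0 *: x - c x i0 *: w.
have xw : g p x w = 0 by rewrite (Defs.metric_sym gm).
have zx : g p z x = - c w i0.
  by rewrite (metricBl gm) !(metricZl gm) xx wx mulr0 subr0 mulrN1.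
have z0 : z = 0.
  apply: g0; first by rewrite clin mulrC subrr.
  rewrite (metricBl gm) !(metricZl gm) !(metricBr gm) !(metricZr gm) xx wx xw.
  rewrite !mulr0 subr0 sub0r mulrN1 !mulrN opprK !mulrA -!expr2 addrC subr_le0.
  apply: (@le_trans _ _ 0); last exact: sqr_ge0.
  by rewrite mulr_ge0_le0 // sqr_ge0.
have cw : c w i0 = 0.
  by apply/eqP; rewrite -oppr_eq0 -zx z0 (metric0l gm).
move: z0; rewrite /z cw scale0r sub0r => /eqP; rewrite oppr_eq0 scaler_eq0.
by rewrite (negbTE cx0) (negbTE w0).
Qed.

Hypotheses (gm : is_pseudo_metric g) (lc : is_levi_civita g nabla).

(** One of the two missing dimensions is lost in passing to the orthogonal space of [u], the other
    in dividing by [u]. *)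
Lemma null_jacobi_exists p u : u != 0 -> g p u u = 0 ->
  exists (Q : vectType R) (Ru : 'End(Q)),
    is_null_jacobi g nabla p u Ru /\ (\dim {:Q}).+2 = m.
Proof.
move=> u0 uu.
have glin : linear (fun y => g p y u : R^o).
  by move=> a x y; rewrite (metricDl gm) (metricZl gm).
pose gL : {linear 'rV[R]_m -> R^o} :=
  HB.pack (fun y => g p y u : R^o) (GRing.isLinear.Build _ _ _ _ _ glin).
pose U := lker (linfun gL).
have UE x : (x \in U) = (g p x u == 0) by rewrite memv_ker lfunE.
pose TL : {linear 'rV[R]_m -> 'rV[R]_m} :=
  HB.pack (fun x => curvature_at nabla p x u u)
    (GRing.isLinear.Build _ _ _ _ _ (curvature_at_linear lc p u u)).
have TU x : x \in U -> TL x \in U.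
  by move=> _; rewrite UE (metric_curvature_at gm lc).
have uU : u \in U by rewrite UE uu.
have [Q [pi [Ru [piP RuE dimQ]]]] :=
  endomorphism_mod_line u0 uU TU (curvature_at_diag lc p u u).
exists Q, Ru; split; first by exists U, pi; split.
rewrite dimQ; have := limg_ker_dim (linfun gL) fullv.
rewrite capfv dimvf /dim /= mul1n => dimE; apply: etrans dimE.
rewrite -addn1; congr (_ + _)%N.
(* The functional g(-, u) has rank one: it is nonzero because [g] is nondegenerate and [u] is
   nonzero. *)
apply/esym/eqP; rewrite eqn_leq; apply/andP; split.
  by have := dimvS (subvf (limg (linfun gL))); rewrite dimvf.
rewrite lt0n dimv_eq0; apply/eqP => im0.
move: u0; apply/negP; rewrite negbK; apply/eqP.
apply: (metric_nondegenerate gm (p := p)) => y.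
rewrite (Defs.metric_sym gm); apply/eqP.
have : linfun gL y \in limg (linfun gL) by exact: memv_img (memvf _).
by rewrite im0 memv0 lfunE.
Qed.

Lemma null_jacobi_eq0 p u (Q : vectType R) (Ru : 'End(Q)) :
  is_null_jacobi g nabla p u Ru -> (forall x, curvature_at nabla p x u u = 0) ->
  Ru = 0.
Proof.
move=> [U [pi [_ [surj _] RuE]]] R0; apply/lfunP => y; rewrite lfunE /=.
have [x <-] := surj y; have [z zE ->] := RuE x.
by rewrite (_ : z = 0) ?linear0 //; apply: val_inj; rewrite /= zE R0.
Qed.

Lemma null_jacobi0_line p u x (Q : vectType R) (Ru : 'End(Q)) :
  is_null_jacobi g nabla p u Ru -> Ru = 0 -> g p x u = 0 ->
  curvature_at nabla p x u u \in <[u]>%VS.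
Proof.
move=> [U [pi [UE [_ ker] RuE]]] Ru0 ux.
have xU : x \in U by have := UE x; rewrite ux eqxx.
have [z] := RuE (vsproj U x); rewrite vsprojK // => <-.
by rewrite Ru0 lfunE /= => /esym/ker.
Qed.

End NullVectors.

(** * Failure of the null Osserman condition *)

Section NullOsserman.
Variables (R : realType) (n s : nat) (M : smoothManifold R (2 * n + s)).
Variables (S : gff_structure M) (eps : 'I_s -> R) (g : two_tensor M).
Variable nabla : vfield M -> vfield M -> vfield M.
Hypotheses (HS : is_indefinite_S S eps g) (lc : is_levi_civita g nabla).

Lemma curvature_at_xi p x a b :
  curvature_at nabla p x (gff_xi S b p) (gff_xi S a p) =
  - (eps a * eps b) *: gff_phi S p (gff_phi S p x).
Proof.
have gm := img_metric (indefS_metric HS).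
have sE := smooth_const_extension p x.
have := curvature_xi HS lc a b (dom_open p) (dom_self p) sE.
rewrite (curvature_tensorial gm lc (dom_open p) (dom_self p) sE (smooth_xi S _ b)
  (smooth_xi S _ a)).
by rewrite const_extension_center.
Qed.

End NullOsserman.

Theorem proposition3p2 (R : realType) (n s : nat) (hs : (1 < s)%N)
    (M : smoothManifold R (2 * n + s)) (S : gff_structure M)
    (eps : 'I_s -> R) (g : two_tensor M)
    (nabla : vfield M -> vfield M -> vfield M) :
  is_indefinite_S S eps g -> is_lorentzian g ->
  eps (Ordinal (ltnW hs)) = -1 ->
  is_levi_civita g nabla ->
  forall p : M, ~ null_osserman g nabla p (gff_xi S (Ordinal (ltnW hs)) p).
Proof.
move=> HS gL; set a1 := Ordinal (ltnW hs); pose a2 := Ordinal hs => eps1 lc p.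
have gm := img_metric (indefS_metric HS).
have a21 : (a2 == a1) = false by [].
pose x1 := gff_xi S a1 p; pose x2 := gff_xi S a2 p.
have m0 : (0 < 2 * n + s)%N by rewrite addn_gt0 (ltnW hs) orbT.
have g11 : g p x1 x1 = -1 by rewrite (img_xi (indefS_metric HS)).
have g21 : g p x2 x1 = 0 by rewrite (metric_xi HS) gff_eta_xi eq_sym a21 mulr0.
have spacelike w : g p w x1 = 0 -> w != 0 -> 0 < g p w w.
  move=> wx w0.
  exact: (@lorentzian_orthogonal_spacelike R _ M g p x1 w (Ordinal m0)).
(* The only timelike direction is already taken: [x2] is orthogonal to [x1], hence spacelike. *)
have eps2 : eps a2 = 1.
  have [//|e2] := img_eps (indefS_metric HS) a2.
  have x20 : x2 != 0.
    apply/eqP => x20; have := gff_eta_xi S p a2 a2; rewrite -/x2 x20 linear0 eqxx.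
    by move/eqP; rewrite eq_sym oner_eq0.
  have := spacelike x2 g21 x20; rewrite (img_xi (indefS_metric HS)) e2.
  by rewrite ltr0N1.
have g22 : g p x2 x2 = 1 by rewrite (img_xi (indefS_metric HS)).
have [w w0 [ww wx1 wphi]] : exists2 w, w != 0 & [/\ g p w w = 1, g p w x1 = 0 &
    gff_phi S p (gff_phi S p w) = - w].
  have [y y0] : exists y, gff_phi S p y != 0.
    apply: contrapT => H; have /eqP := gff_phi_neq0 S p; apply; apply/lfunP => y.
    rewrite lfunE /=; apply/eqP; apply: contrapT => /negP yn.
    by apply: H; exists y.
  set w := gff_phi S p y in y0; have ew b : gff_eta S b p w = 0 by exact: eta_phi.
  have wx1 : g p w x1 = 0 by rewrite (metric_xi HS) ew mulr0.
  have ww := spacelike w wx1 y0.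
  exists ((Num.sqrt (g p w w))^-1 *: w).
    by rewrite scaler_eq0 negb_or invr_eq0 sqrtr_eq0 -ltNge ww.
  split.
  - rewrite (metricZl gm) (metricZr gm) mulrA -expr2 exprVn sqr_sqrtr ?ltW //.
    by rewrite mulVf // gt_eqF.
  - by rewrite (metricZl gm) wx1 mulr0.
  - rewrite !linearZ /= gff_phi2 big1 ?addr0 ?scalerN // => b _.
    by rewrite ew scale0r.
have x1w : g p x1 w = 0 by rewrite (Defs.metric_sym gm).
have x12 : g p x1 x2 = 0 by rewrite (Defs.metric_sym gm).
pose u := x1 + x2; pose v := x1 + w.
have Nu : null_congruence g p x1 u.
  by split; rewrite !(metricDl gm) ?(metricDr gm) g11 g21 ?g22 ?x12 ?addr0 ?add0r ?addNr.
have Nv : null_congruence g p x1 v.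
  by split; rewrite !(metricDl gm) ?(metricDr gm) g11 wx1 ?ww ?x1w ?addr0 ?add0r ?addNr.
have nz y : null_congruence g p x1 y -> y != 0.
  case=> _ yx1; apply/eqP => y0; move: yx1; rewrite y0 (metric0l gm) => /eqP.
  by rewrite eq_sym oppr_eq0 oner_eq0.
have [Qu [Ru [jRu dQu]]] := null_jacobi_exists gm lc (nz u Nu) Nu.1.
have [Qv [Rv [jRv dQv]]] := null_jacobi_exists gm lc (nz v Nv) Nv.1.
(* For [lam = 0] the eigenspaces are the kernels. *)
move=> /(_ u v Nu Nv Qu Qv Ru Rv jRu jRv 0); rewrite /passmx.leigenspace !scale0r !subr0.
have curvE := curvature_at_xi HS lc p.
have -> : Ru = 0.
  apply: (null_jacobi_eq0 jRu) => x.
  rewrite /u (curvature_atDm lc) !(curvature_atDr gm lc) !curvE eps1 eps2.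
  by rewrite !mulr1 !mul1r mulrNN mulr1 opprK !scaleN1r scale1r addNr addrN addr0.
rewrite (_ : lker 0 = fullv); last first.
  by apply/vspaceP => y; rewrite memv_ker lfunE eqxx memvf.
(* Both models have dimension 2n + s - 2, so a kernel of [Rv] as large as all of [Qu] is all of
   [Qv]. *)
have -> : \dim {:Qu} = \dim {:Qv} by apply/eqP; rewrite -eqSS -(inj_eq succn_inj) dQu dQv.
move=> dimE; have /eqP kerE : (lker Rv == fullv).
  by rewrite eqEdim subvf dimE leqnn.
have Rv0 : Rv = 0.
  by apply/lfunP => y; apply/eqP; rewrite lfunE /= -memv_ker kerE memvf.
have vx2 : g p v x2 = 0.
  rewrite (metricDl gm) x12 add0r (metric_xi HS).
  rewrite (_ : gff_eta S a2 p w = 0) ?mulr0 //.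
  by rewrite -[w]opprK -wphi linearN /= eta_phi oppr0.
have x2v : g p x2 v = 0 by rewrite (Defs.metric_sym gm).
(* A vanishing operator only says that R(x2, v) v is a multiple of [v]. Pairing with [x2], which is
   orthogonal to [v], eliminates this multiple and contradicts the value 1. *)
have /vlineP[k kE] := null_jacobi0_line jRv Rv0 x2v.
have Rv2 : curvature_at nabla p x2 v x2 = - w.
  rewrite (curvature_atC lc) curvE eps2 mulr1 scaleN1r opprK.
  by rewrite !linearD /= phi_xi linear0 add0r.
have := congr1 (fun y => g p y x2) kE.
rewrite (metricZl gm) vx2 mulr0 (curvature_at_skew gm lc) Rv2 (metricNr gm) opprK.
by rewrite (metricDl gm) x1w ww add0r => /eqP; rewrite oner_eq0.
Qed.
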